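(* Let $\mathcal M\subseteq\mathcal M^+$ be a model class and $C(T):=\log(T\wedge V(\mathcal M))$. There exist universal constants $C,C'>0$ and $c,c'>0$ such that the following holds. Let $\underline{\varepsilon}(T):=c\cdot\frac{1}{\sqrt{T\,C(T)}}$. For every $T\in\mathbb N$ such that $$\mathrm{dec}^{\mathrm c}_{\mathrm r,\underline{\varepsilon}(T)}(\mathcal M)\ \ge\ C\cdot\underline{\varepsilon}(T),$$ for every regret minimization algorithm there exists a model $M^\star\in\mathcal M$ such that, when $M^\star$ is the true model, $$\mathbb E[\mathrm{Reg}(T)]\ \ge\ c'\cdot\sup_{\bar M\in\mathcal M^+}\mathrm{dec}^{\mathrm c}_{\mathrm r,\underline{\varepsilon}(T)}(\mathcal M\cup\{\bar M\},\bar M)\cdot\frac{T}{\log T}-C'\cdot\frac{\sqrt T}{\log T}\ \ge\ c'\cdot\mathrm{dec}^{\mathrm c}_{\mathrm r,\underline{\varepsilon}(T)}(\mathcal M)\cdot\frac{T}{\log T}-C'\cdot\frac{\sqrt T}{\log T}.$$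
   Context: Setting: $\Pi$ is a measurable decision space and $\mathcal O$ a measurable observation space; rewards lie in $[0,1]$. A model is a probability kernel $M:\Pi\to\Delta([0,1]\times\mathcal O)$, and $\mathcal M^+$ is the set of all models. For a model $M$, $f^M(\pi):=\mathbb E_{(r,o)\sim M(\pi)}[r]$, $\pi_M\in\arg\max_\pi f^M(\pi)$, $g^M(\pi):=f^M(\pi_M)-f^M(\pi)$. $\mathrm{co}(\mathcal M)$ is the set of mixtures $\pi\mapsto\mathbb E_{M\sim\nu}[M(\pi)]$, $\nu\in\Delta(\mathcal M)$. $D^2_H$ is the squared Hellinger distance. $V(\mathcal M):=\max\{e,\ \sup_{M,M'\in\mathcal M}\sup_{\pi}\sup_{A}\frac{M(A\mid\pi)}{M'(A\mid\pi)}\}$ (possibly $+\infty$). Constrained regret DEC: for a class $\mathcal M$, $\bar M\in\mathcal M^+$, $\varepsilon>0$, $$\mathrm{dec}^{\mathrm c}_{\mathrm r,\varepsilon}(\mathcal M,\bar M)=\inf_{p\in\Delta(\Pi)}\sup_{M\in\mathcal M}\Big\{\mathbb E_{\pi\sim p}[g^M(\pi)]\ :\ \mathbb E_{\pi\sim p}[D^2_H(M(\pi),\bar M(\pi))]\le\varepsilon^2\Big\},$$ with value $0$ if no $M$ satisfies the constraint; $\mathrm{dec}^{\mathrm c}_{\mathrm r,\varepsilon}(\mathcal M):=\sup_{\bar M\in\mathrm{co}(\mathcal M)}\mathrm{dec}^{\mathrm c}_{\mathrm r,\varepsilon}(\mathcal M\cup\{\bar M\},\bar M)$. Protocol: with unknown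 true model $M^\star$, a (regret minimization) algorithm at each round $t=1,\dots,T$ selects a distribution $p^t(\cdot\mid\mathfrak H^{t-1})\in\Delta(\Pi)$, draws $\pi^t\sim p^t$, and observes $(r^t,o^t)\sim M^\star(\pi^t)$; $\mathfrak H^t=(\pi^s,r^s,o^s)_{s\le t}$. Regret: $\mathrm{Reg}(T)=\sum_{t=1}^T\mathbb E_{\pi\sim p^t}[g^{M^\star}(\pi)]$; $\mathbb E$ is expectation over the history. *)

(* Defs.v *)
From HB Require Import structures.
From mathcomp Require Import all_boot all_order all_algebra.
From mathcomp Require Import all_classical all_reals all_analysis measurable_realfun.
Import Order.TTheory GRing.Theory Num.Theory.

Set Implicit Arguments.
Unset Strict Implicit.
Unset Printing Implicit Defensive.

Local Open Scope classical_set_scope.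
Local Open Scope ring_scope.

Section hellinger.
Context d (X : measurableType d) (R : realType).
Variables (P Q : probability X R).

Definition hel_dom : set X -> \bar R := measure_add P Q.

HB.instance Definition _ := Measure.on hel_dom.

Let hel_dom_fin : fin_num_fun hel_dom.
Proof.
move=> A mA; rewrite /hel_dom measure_addE fin_numD.
by rewrite !(fin_num_measure _ A mA).
Qed.

HB.instance Definition _ := Measure_isFinite.Build _ X R hel_dom hel_dom_fin.

Local Open Scope charge_scope.

Definition hel_dens (S : probability X R) : X -> \bar R :=
  'd (charge_of_finite_measure S) '/d hel_dom.

Definition hellinger_sq : \bar R :=
  (\int[hel_dom]_x
     ((Num.sqrt (fine (hel_dens P x)) - Num.sqrt (fine (hel_dens Q x))) ^+ 2)%:E)%E.

End hellinger.

Section models.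
Context (R : realType) d1 d2 (Pi : measurableType d1) (O : measurableType d2).

(* A model maps each decision to a distribution over (reward, observation). *)
Definition model := Pi -> probability (R * O)%type R.

Definition Mplus : set model := fun M =>
  (forall A : set (R * O)%type, measurable A ->
     measurable_fun [set: Pi] ((fun pi => M pi A) : Pi -> \bar R)) /\
  (forall pi, M pi (`[0%R, 1%R]%classic `*` [set: O]) = 1%E).

Definition fM (M : model) (pi : Pi) : \bar R := (\int[M pi]_z (z.1)%:E)%E.

Definition gM (M : model) (pi : Pi) : \bar R :=
  (ereal_sup (range (fM M)) - fM M pi)%E.

(* co(M): mixtures pi |-> E_{M ~ nu}[M(pi)], nu a probability on M
   (models indexed measurably by a parameter space Theta). *)
Definition conv_hull (Ms : set model) : set model := fun Mb =>
  exists (d : measure_display) (Theta : measurableType d)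
         (nu : probability Theta R) (phi : Theta -> model),
    (forall th, Ms (phi th)) /\
    (forall A : set (R * O)%type, measurable A ->
       measurable_fun [set: (Theta * Pi)%type] (fun z => phi z.1 z.2 A)) /\
    (forall pi (A : set (R * O)%type), measurable A ->
       Mb pi A = (\int[nu]_th phi th pi A)%E).

Definition sup0 (S : set (\bar R)) : \bar R :=
  if pselect (S = set0) then 0%E else ereal_sup S.

Definition dec_c (Ms : set model) (Mb : model) (eps : R) : \bar R :=
  ereal_inf (range (fun p : probability Pi R =>
    sup0 [set (\int[p]_pi gM M pi)%E | M in
           [set M | Ms M /\
             (\int[p]_pi hellinger_sq (M pi) (Mb pi) <= (eps ^+ 2)%:E)%E]])).

Definition dec_cM (Ms : set model) (eps : R) : \bar R :=
  ereal_sup [set dec_c (Ms `|` [set Mb]) Mb eps | Mb in conv_hull Ms].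

(* ratio a / b in \bar R for nonnegative finite a, b; a/0 = +oo if a > 0,
   0/0 := 0 (irrelevant: V is a max with e). *)
Definition eratio (a b : \bar R) : \bar R :=
  if b == 0%E then (if a == 0%E then 0%E else +oo%E)
  else ((fine a) / (fine b))%:E.

Definition Vcl (Ms : set model) : \bar R :=
  Order.max (expR 1)%:E
    (ereal_sup [set x | exists (M M' : model) (pi : Pi) (A : set (R * O)%type),
                 [/\ Ms M, Ms M', measurable A & x = eratio (M pi A) (M' pi A)]]).

Definition CT (Ms : set model) (T : nat) : R :=
  ln (fine (Order.min (T%:R)%:E (Vcl Ms))).

Definition eps_low (c : R) (Ms : set model) (T : nat) : R :=
  c / Num.sqrt (T%:R * CT Ms T).

Definition step := (Pi * (R * O))%type.

Fixpoint histP (t : nat) : {d : measure_display & measurableType d} :=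
  match t with
  | 0 => existT _ _ (unit : measurableType _)
  | t'.+1 => existT _ _ ((projT2 (histP t') * step)%type : measurableType _)
  end.

Definition hist (t : nat) : measurableType (projT1 (histP t)) := projT2 (histP t).

(* An algorithm: at round t+1, a probability kernel from H^t to Pi. *)
Definition algorithm := forall t : nat, R.-pker (hist t) ~> Pi.

(* Expectation of F(H^t) under the law of the history induced by
   algorithm alg and true model Ms (iterated integrals). *)
Fixpoint Ehist (alg : algorithm) (Mst : model) (t : nat) :
    (hist t -> \bar R) -> \bar R :=
  match t with
  | 0 => fun F => F tt
  | t'.+1 => fun F => Ehist alg Mst (fun h =>
      (\int[alg t' h]_pi \int[Mst pi]_ro F (h, (pi, ro)))%E)
  end.

Definition exp_regret (alg : algorithm) (Mst : model) (T : nat) : \bar R :=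
  (\sum_(t < T) Ehist alg Mst (fun h => \int[alg t h]_pi gM Mst pi))%E.

End models.

(* Main.v *)
(** Fix a base model [Mb] and an algorithm, and run the algorithm on [Mb], but
    override it by a near-optimal decision of [Mb] as soon as its accumulated
    gap for [Mb] exceeds [D T / 16].  The average play [p] has small gap for
    [Mb], so if the constrained DEC at [Mb] exceeds [D], the model that witnesses
    this against [p] is some [M] in the class which is Hellinger-close to [Mb]
    under [p] and whose optimal value exceeds that of [Mb] by about [D].  Hence
    [gM M >= D / 16 + gM Mb - |fM M - fM Mb|], and along every history the
    regret for [M] before the override is of order [D T] (either the override
    never happens, or it happened because the gap for [Mb] was large), up to an
    error that is small in mean under [Mb].

    It remains to transfer this from [Mb] to [M].  With [w] the square root of
    the likelihood ratio, let [W] be the product of the [w]'s along the history,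
    frozen once the accumulated squared Hellinger distance [K] exceeds a small
    constant.  Then [W ^+ 2] is a supermartingale and [W * (1 + K)] a
    submartingale under [Mb], so [W ^+ 2] keeps a constant part of its mass on
    any likely event, and the regret under [M] dominates the expectation of
    [W ^+ 2] times the regret.  No factor [log T] or [log V] is lost.

    The squared Hellinger distance between two kernels need not be measurable
    in the decision when the observation space is not countably generated; then
    the integral in the DEC is a lower integral, and all arguments only use
    measurable minorants of it, through a joint density under [p]. *)
Require Import Defs.
From HB Require Import structures.
From mathcomp Require Import all_boot all_order all_algebra.
From mathcomp Require Import all_classical all_reals all_analysis measurable_realfun.
From mathcomp Require Import ring lra.
Import Order.TTheory GRing.Theory Num.Theory.

Set Implicit Arguments.
Unset Strict Implicit.
Unset Printing Implicit Defensive.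

Local Open Scope classical_set_scope.
Local Open Scope ring_scope.

(** * Integrals of nonnegative real functions *)

Section real_integrals.
Local Open Scope ereal_scope.
Context d (X : measurableType d) (R : realType).
Variable mu : {measure set X -> \bar R}.
Implicit Types f g : X -> R.

Lemma ge0_integralD_EFin f g : measurable_fun setT f -> measurable_fun setT g ->
  (forall x, 0 <= f x)%R -> (forall x, 0 <= g x)%R ->
  \int[mu]_x (f x + g x)%:E = \int[mu]_x (f x)%:E + \int[mu]_x (g x)%:E.
Proof.
move=> mf mg f0 g0; under eq_integral do rewrite EFinD.
rewrite ge0_integralD//; try (by move=> x _; rewrite lee_fin).
  exact/measurable_EFinP.
exact/measurable_EFinP.
Qed.

Lemma ge0_integralZ_EFin k f : measurable_fun setT f ->
  (forall x, 0 <= f x)%R -> (0 <= k)%R ->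
  \int[mu]_x (k * f x)%:E = k%:E * \int[mu]_x (f x)%:E.
Proof.
move=> mf f0 k0; under eq_integral do rewrite EFinM.
rewrite ge0_integralZl//; first exact/measurable_EFinP.
by move=> x _; rewrite lee_fin.
Qed.

Lemma ge0_le_integral_EFin f g : measurable_fun setT f -> measurable_fun setT g ->
  (forall x, 0 <= f x)%R -> (forall x, f x <= g x)%R ->
  \int[mu]_x (f x)%:E <= \int[mu]_x (g x)%:E.
Proof.
move=> mf mg f0 fg; apply: ge0_le_integral => //.
- by move=> x _; rewrite lee_fin.
- exact/measurable_EFinP.
- exact/measurable_EFinP.
- by move=> x _; rewrite lee_fin.
Qed.

Lemma measurable_funV f : measurable_fun setT f -> (forall x, 0 <= f x)%R ->
  measurable_fun setT (fun x => (f x)^-1)%R.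
Proof.
move=> mf f0; rewrite (_ : (fun x => _) = (fun r => r `^ (-1))%R \o f).
  by apply: measurableT_comp => //; exact: measurable_powR.
by apply/funext => x /=; rewrite powR_inv1.
Qed.

Lemma measurable_fun_sqrt f : measurable_fun setT f ->
  measurable_fun setT (fun x => Num.sqrt (f x)).
Proof.
move=> mf; apply: measurableT_comp => //.
by apply: continuous_measurable_fun; exact: sqrt_continuous.
Qed.

Lemma integral_cst_prob (c : \bar R) : mu setT = 1 -> \int[mu]_x c = c.
Proof.
move=> mu1; rewrite -[in RHS](mule1 c) -mu1 -integral_cst//.
Qed.

End real_integrals.

Lemma integral_cst_probability d (X : measurableType d) (R : realType)
    (P : probability X R) (c : \bar R) : (\int[P]_x c = c)%E.
Proof. by apply: integral_cst_prob; exact: probability_setT. Qed.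

Ltac mreal := repeat first
  [ assumption
  | exact: measurable_cst
  | exact: measurable_id
  | exact: measurable_fst
  | exact: measurable_snd
  | apply: measurable_fun_ifT
  | apply: measurable_fun_ler
  | apply: measurable_fun_ltr
  | apply: measurable_fun_sqrt
  | apply: measurable_minr
  | apply: measurable_maxr
  | apply: measurable_funX
  | apply: measurable_funB
  | apply: measurable_funD
  | apply: measurable_funM ].

Ltac nneg := move=> *; repeat first
  [ by [] | by apply/ltW | apply: addr_ge0 | apply: sqr_ge0 | apply: exprn_ge0
  | apply: mulr_ge0 | apply: sqrtr_ge0
  | rewrite invr_ge0 ].

(** From [2 f <= 1 + f ^+ 2] pointwise, so finiteness of the first moment need not be known
    beforehand. *)
Lemma integral_le1_of_sq d (X : measurableType d) (R : realType)
    (P : probability X R) (f : X -> R) : measurable_fun setT f ->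
  (forall x, 0 <= f x)%R -> (\int[P]_x (f x ^+ 2)%:E <= 1)%E ->
  (\int[P]_x (f x)%:E <= 1)%E.
Proof.
move=> mf f0 f2.
have H : (\int[P]_x (2 * f x)%:E <= 2%:E)%E.
  apply: (@le_trans _ _ (\int[P]_x (1 + f x ^+ 2)%:E)%E).
    apply: ge0_le_integral_EFin; [by mreal|by mreal|by nneg|move=> x].
    by have := sqr_ge0 (f x - 1); nra.
  rewrite ge0_integralD_EFin//; try solve [mreal|nneg].
  rewrite integral_cst_probability.
  by apply: (le_trans (leeD2l _ f2)); rewrite -EFinD lee_fin; lra.
rewrite ge0_integralZ_EFin// in H.
by rewrite -(@lee_pmul2l _ 2%:E)// mule1.
Qed.

(** * Pairing of probability kernels *)

Section kernel_pairing.
Local Open Scope ereal_scope.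
Context (R : realType) dw dx dy (W : measurableType dw) (X : measurableType dx)
  (Y : measurableType dy).

Section graph.
Variable k : R.-pker X ~> Y.

Let mpairl (x : X) : measurable_fun [set: Y] (pair x).
Proof. exact: pair1_measurable. Qed.

(** The law of [(x, y)] with [x] fixed and [y] drawn from [k x]. The factor [W] is carried along
    because kernel composition feeds the source of the first kernel to the second one as well. *)
Definition kgraph (z : W * X) : set (X * Y) -> \bar R :=
  pushforward (k z.2) (pair z.2).

Let kgraph0 z : kgraph z set0 = 0.
Proof. by rewrite /kgraph /pushforward preimage_set0 measure0. Qed.

Let kgraph_ge0 z A : 0 <= kgraph z A. Proof. exact: measure_ge0. Qed.

Let kgraph_sigma_additive z : semi_sigma_additive (kgraph z).
Proof.
move=> F mF tF mUF; rewrite /kgraph /pushforward preimage_bigcup.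
apply: measure_semi_sigma_additive.
- by move=> n; rewrite -[X in measurable X]setTI; exact: mpairl.
- move=> i j Di Dj [y [/= Fi Fj]]; apply: (tF i j Di Dj).
  by exists (z.2, y).
- by rewrite -preimage_bigcup -[X in measurable X]setTI; exact: mpairl.
Qed.

HB.instance Definition _ z := isMeasure.Build _ _ _ (kgraph z)
  (kgraph0 z) (kgraph_ge0 z) (@kgraph_sigma_additive z).

Definition mkgraph : W * X -> {measure set (X * Y) -> \bar R} := kgraph.

Let kgraphE z A : kgraph z A = k z.2 (xsection A z.2).
Proof.
by rewrite /kgraph /pushforward xsectionE.
Qed.

Let measurable_kgraph U : measurable U -> measurable_fun [set: W * X] (kgraph ^~ U).
Proof.
move=> mU; rewrite (_ : kgraph ^~ U = (fun x => k x (xsection U x)) \o snd).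
  by apply: measurableT_comp => //; apply: measurable_fun_xsection_finite_kernel; rewrite inE.
by apply/funext => z; rewrite kgraphE.
Qed.

HB.instance Definition _ := isKernel.Build _ _ _ _ _
  mkgraph measurable_kgraph.

Let kgraphT z : kgraph z setT = 1.
Proof. by rewrite /kgraph /pushforward preimage_setT prob_kernel. Qed.

HB.instance Definition _ := Kernel_isProbability.Build _ _ _ _ _
  mkgraph kgraphT.

Lemma integral_kgraph z (F : X * Y -> \bar R) :
  measurable_fun [set: X * Y] F -> (forall u, 0 <= F u) ->
  \int[mkgraph z]_u F u = \int[k z.2]_y F (z.2, y).
Proof. by move=> mF F0; rewrite ge0_integral_pushforward. Qed.
End graph.

Variables (l : R.-pker W ~> X) (k : R.-pker X ~> Y).

Definition kpair : W -> {measure set (X * Y) -> \bar R} := mkcomp l (mkgraph k).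

HB.instance Definition _ := Kernel.on kpair.

Let kpairT w : kpair w setT = 1.
Proof.
rewrite /kpair /mkcomp/= /kcomp.
under eq_integral do rewrite prob_kernel.
by rewrite integral_cst// mul1e prob_kernel.
Qed.

HB.instance Definition _ := Kernel_isProbability.Build _ _ _ _ _ kpair kpairT.

Lemma integral_kpair w (F : X * Y -> \bar R) :
  measurable_fun [set: X * Y] F -> (forall u, 0 <= F u) ->
  \int[kpair w]_u F u = \int[l w]_x \int[k x]_y F (x, y).
Proof.
move=> mF F0; rewrite /kpair [LHS]integral_kcomp//.
by apply: eq_integral => x _; rewrite integral_kgraph.
Qed.

End kernel_pairing.

(** * Hellinger distance *)

Section hellinger_density.
Local Open Scope ereal_scope.
Context d (X : measurableType d) (R : realType) (P Q : probability X R).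
Let S := hel_dom P Q.

(** The densities of [P] and [Q] with respect to [P + Q] add up to 1 almost everywhere, so a single
    function [f] carries both. *)
Lemma hellinger_density : exists f : X -> R,
  [/\ measurable_fun setT f, (forall x, (0 <= f x <= 1)%R),
    (forall F : X -> \bar R, measurable_fun setT F -> (forall x, 0 <= F x) ->
       \int[P]_x F x = \int[S]_x (F x * (f x)%:E)),
    (forall F : X -> \bar R, measurable_fun setT F -> (forall x, 0 <= F x) ->
       \int[Q]_x F x = \int[S]_x (F x * (1 - f x)%:E)) &
    hellinger_sq P Q =
      \int[S]_x ((Num.sqrt (f x) - Num.sqrt (1 - f x)) ^+ 2)%:E].
Proof.
have SE A : S A = P A + Q A by rewrite /S /hel_dom/= measure_addE.
have PS : P `<< S.
  apply/null_content_dominatesP => A mA SA0.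
  have /eqP := SE A; rewrite [S A]SA0 eq_sym.
  by rewrite padde_eq0// => /andP[/eqP].
have QS : Q `<< S.
  apply/null_content_dominatesP => A mA SA0.
  have /eqP := SE A; rewrite [S A]SA0 eq_sym.
  by rewrite padde_eq0// => /andP[_ /eqP].
pose p := Radon_Nikodym_SigmaFinite.f P S.
pose q := Radon_Nikodym_SigmaFinite.f Q S.
have p0 x : 0 <= p x by exact: Radon_Nikodym_SigmaFinite.f_ge0.
have q0 x : 0 <= q x by exact: Radon_Nikodym_SigmaFinite.f_ge0.
have pfin x : p x \is a fin_num by exact: Radon_Nikodym_SigmaFinite.f_fin_num.
have qfin x : q x \is a fin_num by exact: Radon_Nikodym_SigmaFinite.f_fin_num.
have pi : S.-integrable setT p by exact: Radon_Nikodym_SigmaFinite.f_integrable.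
have qi : S.-integrable setT q by exact: Radon_Nikodym_SigmaFinite.f_integrable.
have mp := measurable_int _ pi; have mq := measurable_int _ qi.
have pq1 : ae_eq S setT (p \+ q) (cst 1).
  apply: integral_ae_eq => //; first exact: integrableD.
  move=> E _ mE; rewrite integral_cst// mul1e ge0_integralD//=; last 2 first.
  - exact: measurable_funTS.
  - exact: measurable_funTS.
  by rewrite -!Radon_Nikodym_SigmaFinite.f_integral.
(* Truncation makes the bounds hold at every point. It changes [p] only on a null set, because
   [p <= p + q = 1] almost everywhere. *)
pose f x := Num.min 1%R (fine (p x)).
have mf : measurable_fun setT f.
  by apply: measurable_minr => //; exact: measurableT_comp.
have f01 x : (0 <= f x <= 1)%R.
  by rewrite /f le_min ler01 fine_ge0//= ge_min lexx.
have ep : ae_eq S setT p (EFin \o f).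
  apply: filterS pq1 => x /(_ I)/=; rewrite /f => pq _.
  rewrite min_r ?fineK// -lee_fin fineK//.
  by rewrite -pq leeDl.
have eq1 : ae_eq S setT q (EFin \o (fun x => 1 - f x)%R).
  apply: filterS2 pq1 ep => x /(_ I)/= pq /(_ I) pf _.
  by rewrite EFinB -pq -[(f x)%:E]pf addeAC subee ?add0e.
exists f; split => //.
- move=> F mF F0; rewrite -(Radon_Nikodym_SigmaFinite.change_of_variables PS)//.
  apply: ae_eq_integral => //.
  + by apply: emeasurable_funM.
  + by apply: emeasurable_funM => //; exact/measurable_EFinP.
  + by apply: ae_eqe_mul2l.
- move=> F mF F0; rewrite -(Radon_Nikodym_SigmaFinite.change_of_variables QS)//.
  apply: ae_eq_integral => //.
  + by apply: emeasurable_funM.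
  + by apply: emeasurable_funM => //; apply/measurable_EFinP; exact: measurable_funB.
  + by apply: ae_eqe_mul2l.
(* [hellinger_sq] is defined with derivatives of charges, while [f] comes from the derivative for
   sigma-finite measures; the two versions agree almost everywhere. *)
- rewrite /hellinger_sq /hel_dens -/S.
  have mds (Z : probability X R) : Z `<< S ->
    measurable_fun setT (fine \o Radon_Nikodym (charge_of_finite_measure Z) S).
    by move=> ZS; apply: measurableT_comp.
  have msq : measurable_fun setT (@Num.sqrt R).
    by apply: continuous_measurable_fun; exact: sqrt_continuous.
  apply: ae_eq_integral => //.
  + by apply/measurable_EFinP; apply: measurable_funX; apply: measurable_funB;
      apply: measurableT_comp => //; exact: mds.
  + by apply/measurable_EFinP; apply: measurable_funX; apply: measurable_funB;
      apply: measurableT_comp => //; exact: measurable_funB.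
  have e1 := ae_eq_Radon_Nikodym_SigmaFinite PS measurableT.
  have e2 := ae_eq_Radon_Nikodym_SigmaFinite QS measurableT.
  have e3 := ae_eq_trans (ae_eq_sym e1) ep.
  have e4 := ae_eq_trans (ae_eq_sym e2) eq1.
  by apply: filterS2 e3 e4 => x /(_ I)/= -> /(_ I)/= -> _.
Qed.

End hellinger_density.

Section hellinger_variational.
Local Open Scope ereal_scope.
Context d (X : measurableType d) (R : realType) (P Q : probability X R).
Let S := hel_dom P Q.

Lemma hel_domT : hel_dom P Q setT = 2%:E.
Proof. by rewrite /hel_dom/= measure_addE -[X in X + _]/(P setT) -[X in _ + X]/(Q setT) !probability_setT -EFinD. Qed.

Lemma hellinger_sq_ge0 : 0 <= hellinger_sq P Q.
Proof. by apply: integral_ge0 => x _; rewrite lee_fin sqr_ge0. Qed.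

(* AM-GM: [2 sqrt (f (1 - f)) <= f phi + (1 - f) / phi] *)
Lemma hellinger_sq_ge (phi : X -> R) : measurable_fun setT phi ->
  (forall x, (0 < phi x)%R) ->
  2%:E <= hellinger_sq P Q + (\int[P]_x (phi x)%:E + \int[Q]_x ((phi x)^-1)%:E).
Proof.
move=> mphi phi0.
have [f [mf f01 PE QE ->]] := hellinger_density P Q; rewrite -/S.
have phi1 x : (0 <= phi x)%R by exact: ltW.
have phiV x : (0 <= (phi x)^-1)%R by rewrite invr_ge0.
have mphiV : measurable_fun setT (fun x => (phi x)^-1)%R by exact: measurable_funV.
have f0 x : (0 <= f x)%R by have /andP[] := f01 x.
have f1 x : (0 <= 1 - f x)%R by rewrite subr_ge0; have /andP[] := f01 x.
rewrite PE//; last exact/measurable_EFinP.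
rewrite QE//; last exact/measurable_EFinP.
under [X in _ + (X + _)]eq_integral do rewrite -EFinM.
under [X in _ + (_ + X)]eq_integral do rewrite -EFinM.
rewrite -!ge0_integralD_EFin//; try solve [mreal | nneg].
rewrite -(mul1e 2%:E) -hel_domT -integral_cst//.
apply: ge0_le_integral_EFin; [by mreal|by mreal|by []|move=> x].

set a := Num.sqrt (f x); set b := Num.sqrt (1 - f x).
have -> : f x = (a ^+ 2)%R by rewrite sqr_sqrtr.
have e1 : (1 - a ^+ 2 = b ^+ 2)%R by rewrite !sqr_sqrtr.
rewrite e1 -subr_ge0.
have -> : ((a - b) ^+ 2 + (phi x * a ^+ 2 + (phi x)^-1 * b ^+ 2) - 1 =
   (phi x)^-1 * (phi x * a - b) ^+ 2)%R.
  have -> : (1 = a ^+ 2 + b ^+ 2 :> R)%R by rewrite -e1; ring.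
  by field; rewrite gt_eqF.
by rewrite mulr_ge0 ?sqr_ge0.
Qed.

(** With [a = sqrt f] and [b = sqrt (1 - f)], the difference of densities is [(a - b) * (a + b)];
    weighted AM-GM with weight [la] splits it into [la / 2 * (a - b) ^+ 2] and a rest of at most
    [1 / la], since [(a + b) ^+ 2 <= 2]. The dominating measure has mass 2, whence [2 / la]. *)
Lemma hellinger_sq_mean_diff (r : X -> R) (la : R) : measurable_fun setT r ->
  (forall x, (0 <= r x <= 1)%R) -> (0 < la)%R ->
  \int[P]_x (r x)%:E <= \int[Q]_x (r x)%:E +
    ((la / 2)%:E * hellinger_sq P Q + (2 / la)%:E).
Proof.
move=> mr r01 la0.
have [f [mf f01 PE QE ->]] := hellinger_density P Q; rewrite -/S.
have f0 x : (0 <= f x)%R by have /andP[] := f01 x.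
have f1 x : (0 <= 1 - f x)%R by rewrite subr_ge0; have /andP[] := f01 x.
have r0 x : (0 <= r x)%R by have /andP[] := r01 x.
have lV : (0 <= la^-1)%R by rewrite invr_ge0 ltW.
rewrite PE//; last exact/measurable_EFinP.
rewrite QE//; last exact/measurable_EFinP.
under eq_integral do rewrite -EFinM.
under [X in _ <= (X + _)]eq_integral do rewrite -EFinM.
have -> : (2 / la)%:E = \int[S]_x (la^-1)%:E :> \bar R.
  by rewrite integral_cst// [X in _ * X]hel_domT -EFinM mulrC.
have l2 : (0 <= la / 2)%R by rewrite divr_ge0// ltW.
rewrite -ge0_integralZ_EFin//; [|by mreal|by move=> x; exact: sqr_ge0].
rewrite -!ge0_integralD_EFin//; try solve [mreal | nneg].
apply: ge0_le_integral_EFin; [by mreal|by mreal|by move=> x; rewrite mulr_ge0|move=> x].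
set a := Num.sqrt (f x); set b := Num.sqrt (1 - f x).
have -> : f x = (a ^+ 2)%R by rewrite sqr_sqrtr.
have e1 : (1 - a ^+ 2 = b ^+ 2)%R by rewrite !sqr_sqrtr.
have a0 : (0 <= a)%R by exact: sqrtr_ge0.
have b0 : (0 <= b)%R by exact: sqrtr_ge0.
rewrite e1 -subr_ge0.
have /andP[rr0 rr1] := r01 x; move: (r x) rr0 rr1 => s s0 s1.
have H : (0 <= la^-1 / 2 * (la * (a - b) - (a + b) * s) ^+ 2)%R.
  by rewrite mulr_ge0 ?sqr_ge0// divr_ge0.
have e2 : (la^-1 / 2 * (la * (a - b) - (a + b) * s) ^+ 2 =
  la / 2 * (a - b) ^+ 2 - s * (a ^+ 2 - b ^+ 2) +
  la^-1 * ((a + b) ^+ 2 * s ^+ 2 / 2))%R.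
  by field; rewrite gt_eqF.
rewrite e2 in H; apply: (le_trans H).
have ab : ((a + b) ^+ 2 * s ^+ 2 / 2 <= 1)%R.
  have ab2 : ((a + b) ^+ 2 <= 2)%R by have := sqr_ge0 (a - b); nra.
  have s2 : (s ^+ 2 <= 1)%R by nra.
  have := ler_pM (sqr_ge0 (a + b)) (sqr_ge0 s) ab2 s2; lra.
have := ler_wpM2l lV ab; rewrite mulr1 => H2.
lra.
Qed.

End hellinger_variational.

(** * Densities *)

Section lower_integral.
Local Open Scope ereal_scope.

(* No measurability is required: the integral of a nonnegative function is a
   supremum over the simple functions below it. *)
Lemma ge0_le_lower_integral d (X : measurableType d) (R : realType)
    (mu : {measure set X -> \bar R}) (f g : X -> \bar R) :
  (forall x, 0 <= f x) -> (forall x, f x <= g x) ->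
  \int[mu]_x f x <= \int[mu]_x g x.
Proof.
move=> f0 fg; rewrite !ge0_integralTE//; last by move=> x; exact: le_trans (fg x).
apply: le_ereal_sup => _ [h hf <-]; exists h => // x.
exact: le_trans (fg x).
Qed.

End lower_integral.

Section density_measure.
Local Open Scope ereal_scope.
Context d (X : measurableType d) (R : realType).

(** The measure with density [g] with respect to [mu]. The two proofs are arguments of the name so
    that the measure instances can be attached to it. *)
Definition mdens (mu : probability X R) (g : X -> R)
    (mg : measurable_fun setT g) (g01 : forall x, (0 <= g x <= 1)%R) :=
  fun A : set X => \int[mu]_(x in A) (g x)%:E.

Variables (mu : probability X R) (g : X -> R).
Hypotheses (mg : measurable_fun setT g) (g01 : forall x, (0 <= g x <= 1)%R).

Let g0 x : 0 <= (g x)%:E. Proof. by rewrite lee_fin; have /andP[] := g01 x. Qed.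
Let mgE : measurable_fun setT (EFin \o g). Proof. exact/measurable_EFinP. Qed.

Let mdens0 : mdens mu mg g01 set0 = 0. Proof. exact: integral_set0. Qed.
Let mdens_ge0 A : 0 <= mdens mu mg g01 A.
Proof. by apply: integral_ge0 => x _. Qed.
Let mdens_sigma_additive : semi_sigma_additive (mdens mu mg g01).
Proof. exact: semi_sigma_additive_nng_induced. Qed.

HB.instance Definition _ := isMeasure.Build _ _ _ (mdens mu mg g01)
  mdens0 mdens_ge0 mdens_sigma_additive.

Let mdens_fin : fin_num_fun (mdens mu mg g01).
Proof.
apply: lty_fin_num_fun; apply: (@le_lt_trans _ _ (\int[mu]_x (cst 1) x)).
  apply: ge0_le_integral => // x _.
  by rewrite lee_fin; have /andP[] := g01 x.
by rewrite integral_cst// mul1e [X in X < _]probability_setT ltry.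
Qed.

HB.instance Definition _ := Measure_isFinite.Build _ _ _ (mdens mu mg g01)
  mdens_fin.

Lemma integral_mdens (F : X -> \bar R) : measurable_fun setT F ->
  (forall x, 0 <= F x) ->
  \int[mdens mu mg g01]_x F x = \int[mu]_x (F x * (g x)%:E).
Proof.
move=> mF F0.
have dom : mdens mu mg g01 `<< mu.
  by apply/null_content_dominatesP => A mA A0; apply: null_set_integral => //;
    exact: measurable_funTS.
rewrite -(Radon_Nikodym_SigmaFinite.change_of_variables dom)//.
have fi := Radon_Nikodym_SigmaFinite.f_integrable dom.
have mf := measurable_int _ fi.
apply: ae_eq_integral => //.
- exact: emeasurable_funM.
- exact: emeasurable_funM.
apply: ae_eqe_mul2l; apply: integral_ae_eq => // E _ mE.
by rewrite -Radon_Nikodym_SigmaFinite.f_integral.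
Qed.

End density_measure.

Section density_unique.
Local Open Scope ereal_scope.
Context d1 d2 (X : measurableType d1) (Y : measurableType d2) (R : realType).

(** Two finite measures that agree on the rectangles, a generating pi-system, are equal. Checking
    one rectangle at a time allows the exceptional null set to depend on the side [C], which is what
    makes the argument work when [Y] is not countably generated. *)
Lemma eq_density_on_rectangles (a b : probability (X * Y)%type R)
    (g h : X * Y -> R) :
  measurable_fun setT g -> measurable_fun setT h ->
  (forall x, (0 <= g x <= 1)%R) -> (forall x, (0 <= h x <= 1)%R) ->
  (forall E C, measurable E -> measurable C ->
    \int[a]_(x in E `*` C) (g x)%:E = \int[b]_(x in E `*` C) (h x)%:E) ->
  forall F, measurable_fun setT F -> (forall x, 0 <= F x) ->
  \int[a]_x (F x * (g x)%:E) = \int[b]_x (F x * (h x)%:E).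
Proof.
move=> mg mh g01 h01 gh F mF F0.
rewrite -(integral_mdens a mg g01)// -(integral_mdens b mh h01)//.
apply: eq_measure_integral => A mA _.
pose G : set (set (X * Y)) := [set E `*` C | E in measurable & C in measurable].
apply: (measure_unique G (fun=> setT)) => //.
- by rewrite measurable_prod_measurableType.
- move=> _ _ [X1 mX1 [X2 mX2 <-]] [Y1 mY1 [Y2 mY2 <-]].
  rewrite -setXI; exists (X1 `&` Y1); first exact: measurableI.
  by exists (X2 `&` Y2) => //; exact: measurableI.
- by move=> _; exists setT => //; exists setT => //; rewrite setXTT.
- by rewrite bigcup_const.
- by move=> _ [E mE [C mC <-]]; exact: gh.
- move=> _; rewrite -ge0_fin_numE//.
  exact: fin_num_measure.
Qed.

End density_unique.

(** * Kernels built from laws and models *)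

Section kernels.
Local Open Scope ereal_scope.
Context (R : realType).

Section kprob.
Context d1 d2 (X : measurableType d1) (Y : measurableType d2).
Variables (k : R.-pker X ~> Y) (x : X).

(** The value of a probability kernel at a point is typed as a measure; this name gives it the type
    [probability]. *)
Definition kprob : set Y -> \bar R := k x.
HB.instance Definition _ := Measure.on kprob.
Let kprobT : kprob setT = 1. Proof. exact: prob_kernel. Qed.
HB.instance Definition _ := Measure_isProbability.Build _ _ _ kprob kprobT.
End kprob.

Section kcst.
Context d1 d2 (X : measurableType d1) (Y : measurableType d2).
Variable P : probability Y R.

(** With source [unit], pairing [kcst P] with a kernel yields the joint law of a first coordinate
    drawn from [P] and a second one drawn from the kernel. *)
Definition kcst : X -> {measure set Y -> \bar R} := fun=> P.
Let mkcst U : measurable U -> measurable_fun setT (kcst ^~ U).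
Proof. by move=> mU; exact: measurable_cst. Qed.
HB.instance Definition _ := isKernel.Build _ _ _ _ _ kcst mkcst.
Let kcstT x : kcst x setT = 1. Proof. exact: probability_setT. Qed.
HB.instance Definition _ := Kernel_isProbability.Build _ _ _ _ _ kcst kcstT.
End kcst.

Section ksnd.
Context d0 d1 d2 (W : measurableType d0) (X : measurableType d1)
  (Y : measurableType d2).
Variable k : R.-pker X ~> Y.

Definition ksnd : W * X -> {measure set Y -> \bar R} := fun z => k z.2.
Let mksnd U : measurable U -> measurable_fun setT (ksnd ^~ U).
Proof.
move=> mU; apply: (measurableT_comp (measurable_kernel k U mU)) => //.
Qed.
HB.instance Definition _ := isKernel.Build _ _ _ _ _ ksnd mksnd.
Let ksndT x : ksnd x setT = 1. Proof. exact: prob_kernel. Qed.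
HB.instance Definition _ := Kernel_isProbability.Build _ _ _ _ _ ksnd ksndT.
End ksnd.

End kernels.

Section kmod.
Local Open Scope ereal_scope.
Context (R : realType) d1 d2 (X : measurableType d1) (Y : measurableType d2).

Definition kmod (M : X -> probability Y R)
    (mM : forall A, measurable A -> measurable_fun setT (fun x => M x A)) :
  X -> {measure set Y -> \bar R} := M.

Variable M : X -> probability Y R.
Hypothesis mM : forall A, measurable A -> measurable_fun setT (fun x => M x A).

HB.instance Definition _ := isKernel.Build _ _ _ _ _ (kmod mM) mM.
Let kmodT x : kmod mM x setT = 1. Proof. exact: probability_setT. Qed.
HB.instance Definition _ := Kernel_isProbability.Build _ _ _ _ _ (kmod mM) kmodT.

Lemma measurable_integral_kmod (F : X * Y -> \bar R) :
  measurable_fun setT F -> (forall u, 0 <= F u) ->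
  measurable_fun setT (fun x => \int[M x]_y F (x, y)).
Proof.
by move=> mF F0; exact: (measurable_fun_integral_finite_kernel F (kmod mM)).
Qed.

End kmod.

(** * A jointly measurable likelihood ratio for two kernels *)

Section joint_density.
Local Open Scope ereal_scope.
Context (R : realType) d1 d2 (X : measurableType d1) (Y : measurableType d2).
Variables (p : probability X R) (M M' : X -> probability Y R).
Hypothesis mM : forall A, measurable A -> measurable_fun setT (fun x => M x A).
Hypothesis mM' : forall A, measurable A -> measurable_fun setT (fun x => M' x A).

(* [w] plays the part of the square root of the likelihood ratio [dM / dM'].
   The last clause states [w ^+ 2 * M' <= M] in the only form that survives when
   [Y] is not countably generated: integrated against any law on [H * X] whose
   [X]-marginal is dominated by [p]. *)
Definition likelihood_root (w : X * Y -> R) : Prop :=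
  [/\ measurable_fun setT w, (forall u, 0 <= w u)%R,
    (forall x, \int[M' x]_y (w (x, y) ^+ 2)%:E <= 1),
    \int[p]_x (2 - 2 * fine (\int[M' x]_y (w (x, y))%:E))%:E <=
      \int[p]_x hellinger_sq (M x) (M' x) &
    forall d (H : measurableType d) (J : probability (H * X)%type R)
        (act : H -> bool), measurable_fun setT act ->
      (forall N, measurable N -> p N = 0 -> J [set x | act x.1 /\ N x.2] = 0) ->
      forall F : (H * X) * Y -> \bar R, measurable_fun setT F ->
      (forall u, 0 <= F u) ->
      \int[J]_x (((act x.1)%:R)%:E *
        \int[M' x.2]_y (F (x, y) * (w (x.2, y) ^+ 2)%:E)) <=
      \int[J]_x (((act x.1)%:R)%:E * \int[M x.2]_y F (x, y))].

(** The two joint laws with common marginal [p]. A density of one against their sum is measurable in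
    both variables at once, unlike densities chosen separately for each [x]. *)
Let P := kprob (kpair (kcst (X := unit) p) (kmod mM)) tt.
Let Q := kprob (kpair (kcst (X := unit) p) (kmod mM')) tt.

Let integralP F : measurable_fun setT F -> (forall u, 0 <= F u) ->
  \int[P]_u F u = \int[p]_x \int[M x]_y F (x, y).
Proof. by move=> mF F0; rewrite [LHS]integral_kpair. Qed.

Let integralQ F : measurable_fun setT F -> (forall u, 0 <= F u) ->
  \int[Q]_u F u = \int[p]_x \int[M' x]_y F (x, y).
Proof. by move=> mF F0; rewrite [LHS]integral_kpair. Qed.

Section with_density.
Variable f : X * Y -> R.
Let S := hel_dom P Q.
Hypotheses (mf : measurable_fun setT f) (f01 : forall x, (0 <= f x <= 1)%R).
Hypothesis PE : forall F, measurable_fun setT F -> (forall u, 0 <= F u) ->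
  \int[P]_u F u = \int[S]_u (F u * (f u)%:E).
Hypothesis QE : forall F, measurable_fun setT F -> (forall u, 0 <= F u) ->
  \int[Q]_u F u = \int[S]_u (F u * (1 - f u)%:E).

Let f0 u : (0 <= f u)%R. Proof. by have /andP[] := f01 u. Qed.
Let f1 u : (0 <= 1 - f u)%R.
Proof. by rewrite subr_ge0; have /andP[] := f01 u. Qed.

(** Both sides are the integral of [F * f * (1 - f)] against [S]. *)
Let relPQ (F : X * Y -> R) : measurable_fun setT F -> (forall u, 0 <= F u)%R ->
  \int[P]_u (F u * (1 - f u))%:E = \int[Q]_u (F u * f u)%:E.
Proof.
move=> mF F0; rewrite PE; [|by apply/measurable_EFinP; mreal|by move=> u; rewrite lee_fin; nneg].
rewrite QE; [|by apply/measurable_EFinP; mreal|by move=> u; rewrite lee_fin; nneg].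
by apply: eq_integral => u _; rewrite -!EFinM mulrAC.
Qed.

(** The inverse of [1 - f], set to 0 where [f = 1], a set that [Q] does not charge; [g * f] is the
    density of the part of [P] that is absolutely continuous with respect to [Q]. *)
Let g u : R := if (f u < 1)%R then ((1 - f u)^-1)%R else 0%R.
Let mg : measurable_fun setT g.
Proof. by rewrite /g; mreal; apply: measurable_funV => //; mreal. Qed.
Let g0 u : (0 <= g u)%R. Proof. by rewrite /g; case: ifP => // _; rewrite invr_ge0. Qed.
Let gf1 u : (g u * (1 - f u) <= 1)%R.
Proof.
rewrite /g; case: ifPn => [fu|_]; last by rewrite mul0r.
by rewrite mulVf// gt_eqF// subr_gt0.
Qed.

Let I x : \bar R := \int[M' x]_y (g (x, y) * f (x, y))%:E.
Let mgf : measurable_fun setT (fun u => (g u * f u)%:E).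
Proof. by apply/measurable_EFinP; mreal. Qed.
Let gf0 u : 0 <= (g u * f u)%:E. Proof. by rewrite lee_fin; nneg. Qed.
Let mI : measurable_fun setT I.
Proof. exact: (measurable_integral_kmod mM' mgf). Qed.
Let I0 x : 0 <= I x. Proof. by apply: integral_ge0 => y _. Qed.

Let B := [set x | 1 < I x].
Let mB : measurable B.
Proof. by rewrite /B -[X in measurable X]setTI; exact: emeasurable_fun_o_infty. Qed.

(** By [relPQ] and [g * (1 - f) <= 1], the integral of [I] over [B] is at most [p B], although
    [I > 1] on [B]. *)
Let pB : p B = 0.
Proof.
have mI1 : measurable_fun setT (fun x => (\1_B x)%:E * I x).
  by apply: emeasurable_funM => //; exact/measurable_EFinP.
have IB : \int[p]_(x in B) I x <= p B.
  rewrite integral_mkcond/=.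
  rewrite (eq_integral (fun x => \int[M' x]_y (\1_B x * g (x, y) * f (x, y))%:E)); last first.
    move=> x _; rewrite patchE indicE; case: ifPn => xB.
      by apply: eq_integral => y _; rewrite mul1r.
    by rewrite integral0_eq// => y _; rewrite !mul0r.
  have mi : measurable_fun setT (\1_B : X -> R) by exact: measurable_indic.
  have m1 : measurable_fun setT (fun u : X * Y => \1_B u.1 : R).
    exact: (measurableT_comp mi measurable_fst).
  have m2 : measurable_fun setT (fun u : X * Y => \1_B u.1 * g u)%R by mreal.
  have i0 x : (0 <= \1_B x :> R)%R by rewrite indicE.
  rewrite -(integralQ (F := fun u => (\1_B u.1 * g u * f u)%:E)); last 2 first.
  - by apply/measurable_EFinP; mreal.
  - by move=> u; rewrite lee_fin; nneg.
  rewrite -(relPQ (F := fun u => (\1_B u.1 * g u)%R))//; last by nneg.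
  have m3 : measurable_fun setT (fun u => (\1_B u.1 * g u * (1 - f u))%R) by mreal.
  apply: (@le_trans _ _ (\int[P]_u (\1_B u.1)%:E)).
    apply: ge0_le_integral_EFin => //; first by nneg.
    by move=> u; rewrite -mulrA ler_piMr.
  rewrite integralP; [|exact/measurable_EFinP|by move=> u; rewrite lee_fin].
  rewrite (eq_integral (fun x => (\1_B x)%:E)).
    by rewrite integral_indic// setIT.
  by move=> x _; rewrite /= integral_cst_probability.
have mIB : measurable_fun B (fun x => I x - 1).
  by apply: measurable_funTS; exact: emeasurable_funB.
have I10 x : B x -> 0 <= I x - 1 by move=> xB; rewrite sube_ge0 ?ltW.
have : \int[p]_(x in B) (I x - 1) = 0.
  apply/eqP; rewrite eq_le integral_ge0// andbT.
  have : p B + \int[p]_(x in B) (I x - 1) <= p B.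
    rewrite -[X in X + _](mul1e (p B)) -integral_cst// -ge0_integralD//.
    rewrite (eq_integral I)// => x; rewrite inE => xB.
    by case: (I x) => [r| |] //=; rewrite -EFinB -EFinD addrC subrK.
  by rewrite -[leRHS]adde0 leeD2lE ?fin_num_measure.
rewrite (eq_integral (fun x => `|I x - 1|)); last first.
  by move=> x; rewrite inE => xB; rewrite gee0_abs// I10.
move=> /(ae_eq_integral_abs p mB mIB)[N [mN pN BN]].
apply/eqP; rewrite eq_le measure_ge0 andbT -pN le_measure ?inE//.
move=> x xB; apply: BN => /= /(_ xB); move: xB; rewrite /B/=.
case: (I x) => [r| |] //; rewrite lte_fin -EFinB => r1 [] /eqP.
by rewrite subr_eq0 gt_eqF.
Qed.

(** Putting 0 over the null set [B] makes the second moment at most 1 for every [x], as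
    [likelihood_root] demands, and not just for almost every one. *)
Let w u : R := if I u.1 <= 1 then Num.sqrt (g u * f u) else 0%R.
Let mw : measurable_fun setT w.
Proof.
rewrite /w; apply: measurable_fun_ifT => //; last by mreal.
apply: measurable_fun_lee => //.
by apply: measurableT_comp.
Qed.
Let w0 u : (0 <= w u)%R. Proof. by rewrite /w; case: ifP => _ //; exact: sqrtr_ge0. Qed.
Let w2 u : (w u ^+ 2 <= g u * f u)%R.
Proof. by rewrite /w; case: ifP => _; rewrite ?sqr_sqrtr ?expr0n//=; nneg. Qed.

Let w2_le1 x : \int[M' x]_y (w (x, y) ^+ 2)%:E <= 1.
Proof.
have mw' : measurable_fun setT (fun y => w (x, y)).
  by apply: (measurableT_comp mw); exact: pair1_measurable.
have [Ix|Ix] := leP (I x) 1.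
  apply: le_trans Ix; apply: ge0_le_integral_EFin => //; first by mreal.
  - apply: (measurableT_comp (f := fun u => (g u * f u)%R)); first by mreal.
    exact: pair1_measurable.
  - by move=> y; exact: sqr_ge0.
rewrite integral0_eq// => y _.
by rewrite /w /= leNgt Ix expr0n.
Qed.

Let mwx x : measurable_fun setT (fun y => w (x, y)).
Proof. by apply: (measurableT_comp mw); exact: pair1_measurable. Qed.

Let w_le1 x : \int[M' x]_y (w (x, y))%:E <= 1.
Proof. exact: integral_le1_of_sq. Qed.

Let v x := fine (\int[M' x]_y (w (x, y))%:E).
Let mwE : measurable_fun setT (EFin \o w). Proof. exact/measurable_EFinP. Qed.
Let mintw : measurable_fun setT (fun x => \int[M' x]_y (w (x, y))%:E).
Proof. by apply: (measurable_integral_kmod mM' mwE) => u; rewrite lee_fin. Qed.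
Let mv : measurable_fun setT v. Proof. exact: measurableT_comp. Qed.
Let intw0 x : 0 <= \int[M' x]_y (w (x, y))%:E.
Proof. by apply: integral_ge0 => y _; rewrite lee_fin. Qed.
Let vE x : (v x)%:E = \int[M' x]_y (w (x, y))%:E.
Proof. by rewrite /v fineK// ge0_fin_numE// (le_lt_trans (w_le1 x))// ltry. Qed.
Let v0 x : (0 <= v x)%R. Proof. by rewrite -lee_fin vE. Qed.
Let v1 x : (v x <= 1)%R. Proof. by rewrite -lee_fin vE. Qed.

Let A : \bar R := \int[S]_u (Num.sqrt (f u) * Num.sqrt (1 - f u))%:E.

(** [A] is the Hellinger affinity of the joint laws [P] and [Q]; the change made on [B] is invisible
    to [p], and [sqrt (g * f) * (1 - f) = sqrt f * sqrt (1 - f)]. *)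
Let vA : \int[p]_x (v x)%:E = A.
Proof.
have mq : measurable_fun setT (fun u => (Num.sqrt (g u * f u))%:E).
  by apply/measurable_EFinP; mreal.
transitivity (\int[p]_x \int[M' x]_y (Num.sqrt (g (x, y) * f (x, y)))%:E).
  apply: ge0_ae_eq_integral => //.
  - exact/measurable_EFinP.
  - by apply: (measurable_integral_kmod mM' mq) => u; rewrite lee_fin sqrtr_ge0.
  - by move=> x _; rewrite lee_fin.
  - by move=> x _; apply: integral_ge0 => y _; rewrite lee_fin sqrtr_ge0.
  - exists B; split => // x /= Hx; rewrite /B/= ltNge; apply/negP => Ix.
    by apply: Hx => _; rewrite vE; apply: eq_integral => y _; rewrite /w/= Ix.
rewrite -(integralQ mq); last by move=> u; rewrite lee_fin sqrtr_ge0.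
rewrite QE//.
apply: eq_integral => u _; rewrite -EFinM; congr EFin.
rewrite sqrtrM// mulrC [RHS]mulrC mulrA; congr (_ * _)%R.
rewrite /g; case: ifPn => [fu|].
  rewrite sqrtrV// -[X in (X / _)%R](sqr_sqrtr (f1 u)) expr2 mulfK//.
  by rewrite sqrtr_eq0 -ltNge subr_gt0.
rewrite -leNgt => fu; have -> : (1 - f u = 0)%R.
  by apply/eqP; rewrite eq_le f1 subr_le0 fu.
by rewrite mul0r sqrtr0.
Qed.

Let A0 : 0 <= A.
Proof. by apply: integral_ge0 => u _; rewrite lee_fin; nneg. Qed.
Let A1 : A <= 1.
Proof.
rewrite -vA -[X in _ <= X](integral_cst_probability p).
by apply: ge0_le_integral_EFin.
Qed.

Let gapA : \int[p]_x (2 - 2 * v x)%:E + 2%:E * A = 2%:E.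
Proof.
have v2 x : (0 <= 2 - 2 * v x)%R by have := v1 x; lra.
rewrite -vA -ge0_integralZ_EFin// -ge0_integralD_EFin//; try solve [mreal|nneg].
under eq_integral do rewrite subrK.
by rewrite integral_cst_probability.
Qed.

(** The variational bound [hellinger_sq_ge] is used at each [x] with one jointly measurable [phi],
    and only the resulting measurable minorant is integrated. *)
Let hellinger_lower (e : R) : (0 < e)%R ->
  2%:E <= \int[p]_x hellinger_sq (M x) (M' x) + (2%:E * A + (4 * e)%:E).
Proof.
move=> e0.
(* The optimal [phi] would be [sqrt ((1 - f) / f)]; adding [e ^+ 2] keeps it positive and finite.
   The cost is [2 * e] at each point, hence [4 * e] against [S], whose mass is 2. *)
pose b u := Num.sqrt (1 - f u + e ^+ 2).
pose a u := Num.sqrt (f u + e ^+ 2).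
have e2 : (0 < e ^+ 2)%R by rewrite exprn_gt0.
have a0 u : (0 < a u)%R by rewrite sqrtr_gt0 ltr_wpDl.
have b0 u : (0 < b u)%R by rewrite sqrtr_gt0 ltr_wpDl.
have ma : measurable_fun setT a by rewrite /a; mreal.
have mb : measurable_fun setT b by rewrite /b; mreal.
have maV : measurable_fun setT (fun u => (a u)^-1)%R.
  by apply: measurable_funV => // u; exact: ltW.
have mbV : measurable_fun setT (fun u => (b u)^-1)%R.
  by apply: measurable_funV => // u; exact: ltW.
pose phi u := (b u / a u)%R.
have mphi : measurable_fun setT phi by rewrite /phi; mreal.
have phi0 u : (0 < phi u)%R by rewrite divr_gt0.
have phi0' u : (0 <= phi u)%R by exact: ltW.
have phiV u : (0 <= (phi u)^-1)%R by rewrite invr_ge0.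
have mphiV : measurable_fun setT (fun u => (phi u)^-1)%R.
  exact: measurable_funV.
pose U x : \bar R := \int[M x]_y (phi (x, y))%:E.
pose V x : \bar R := \int[M' x]_y ((phi (x, y))^-1)%:E.
have mphiE : measurable_fun setT (EFin \o phi) by exact/measurable_EFinP.
have mphiVE : measurable_fun setT (fun u => ((phi u)^-1)%:E) by exact/measurable_EFinP.
have mU : measurable_fun setT U.
  by apply: (measurable_integral_kmod mM mphiE) => u; rewrite lee_fin.
have mV : measurable_fun setT V.
  by apply: (measurable_integral_kmod mM' mphiVE) => u; rewrite lee_fin.
have U0 x : 0 <= U x by apply: integral_ge0 => y _; rewrite lee_fin.
have V0 x : 0 <= V x by apply: integral_ge0 => y _; rewrite lee_fin.
have mUV : measurable_fun setT (fun x => U x + V x) by exact: emeasurable_funD.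
have UVE : \int[p]_x (U x + V x) <= 2%:E * A + (4 * e)%:E.
  rewrite ge0_integralD// -(integralP mphiE); last by move=> u; rewrite lee_fin.
  rewrite -(integralQ mphiVE); last by move=> u; rewrite lee_fin.
  rewrite PE// QE//.
  under eq_integral do rewrite /= -EFinM.
  under [X in _ + X]eq_integral do rewrite -EFinM.
  have -> : (4 * e)%:E = \int[S]_u (2 * e)%:E.
    rewrite integral_cst// [X in _ * X]hel_domT.
    by rewrite -EFinM; congr EFin; ring.
  have s0 u : (0 <= Num.sqrt (f u))%R := sqrtr_ge0 _.
  have s1 u : (0 <= Num.sqrt (1 - f u))%R := sqrtr_ge0 _.
  rewrite /A -ge0_integralZ_EFin//; try solve [mreal|nneg].
  rewrite -!ge0_integralD_EFin//; try solve [mreal|nneg].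
  apply: ge0_le_integral_EFin; [by mreal|by mreal|by nneg|move=> u].
  have fE := sqr_sqrtr (f0 u); have fE1 := sqr_sqrtr (f1 u).
  have aE : (a u ^+ 2 = f u + e ^+ 2)%R by rewrite sqr_sqrtr// addr_ge0// ltW.
  have bE : (b u ^+ 2 = 1 - f u + e ^+ 2)%R by rewrite sqr_sqrtr// addr_ge0// ltW.
  have aN := a0 u; have bN := b0 u.
  rewrite -{1}fE -{1}fE1.
  move: (s0 u) (s1 u) fE fE1.
  set r := Num.sqrt (f u); set q := Num.sqrt (1 - f u) => r0 q0 fE fE1.
  have ra : (r <= a u)%R by apply: ler_wsqrtr; rewrite lerDl ltW.
  have qb : (q <= b u)%R by apply: ler_wsqrtr; rewrite lerDl ltW.
  have ae : (a u <= r + e)%R.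
    have : (a u ^+ 2 <= (r + e) ^+ 2)%R by rewrite aE -fE; nra.
    by rewrite ler_sqr// nnegrE; nneg.
  have be : (b u <= q + e)%R.
    have : (b u ^+ 2 <= (q + e) ^+ 2)%R by rewrite bE -fE1; nra.
    by rewrite ler_sqr// nnegrE; nneg.
  have r1 : (r <= 1)%R by have := f1 u; nra.
  have q1 : (q <= 1)%R by have := f0 u; nra.
  have h1 : (phi u * r ^+ 2 <= r * q + e)%R.
    apply: (@le_trans _ _ (b u * r)%R); last by nra.
    rewrite /phi -mulrA ler_pM2l// mulrC ler_pdivrMr// expr2 ler_wpM2l//.
  have h2 : ((phi u)^-1 * q ^+ 2 <= r * q + e)%R.
    apply: (@le_trans _ _ (a u * q)%R); last by nra.
    rewrite /phi invf_div -mulrA ler_pM2l// mulrC ler_pdivrMr// expr2 ler_wpM2l//.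
  lra.
have hV x : 2%:E <= hellinger_sq (M x) (M' x) + (U x + V x).
  apply: hellinger_sq_ge => //.
  by apply: (measurableT_comp mphi); exact: pair1_measurable.
(* The measurable minorant of the squared Hellinger distance. *)
pose H x : \bar R := maxe 0 (2%:E - (U x + V x)).
have mH : measurable_fun setT H.
  by apply: measurable_maxe => //; exact: emeasurable_funB.
have H0 x : 0 <= H x by rewrite /H le_max lexx.
have HUV x : 2%:E <= H x + (U x + V x).
  have := adde_ge0 (U0 x) (V0 x); rewrite /H; case: (U x + V x) => [r| |] // r0.
    by rewrite -EFinB -EFin_max -EFinD lee_fin -lerBlDr le_max lexx orbT.
  by rewrite addey ?leey.
have Hh x : H x <= hellinger_sq (M x) (M' x).
  rewrite /H ge_max hellinger_sq_ge0/=.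
  have := hV x; have := hellinger_sq_ge0 (M x) (M' x).
  have := adde_ge0 (U0 x) (V0 x).
  case: (U x + V x) => [r| |] //; case: (hellinger_sq _ _) => [h| |] //=.
  - by rewrite -EFinD -EFinB !lee_fin => *; lra.
  - by move=> *; rewrite leey.
  - by move=> *; rewrite leNye.
have h2 : 2%:E <= \int[p]_x (H x + (U x + V x)).
  rewrite -[X in X <= _](integral_cst_probability p).
  by apply: ge0_le_integral => //; exact: emeasurable_funD.
apply: (le_trans h2); rewrite ge0_integralD//; last by move=> x _; exact: adde_ge0.
apply: leeD UVE.
exact: ge0_le_lower_integral.
Qed.

Let gap_le : \int[p]_x (2 - 2 * v x)%:E <= \int[p]_x hellinger_sq (M x) (M' x).
Proof.
have A2fin : 2%:E * A \is a fin_num.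
  by rewrite fin_numM// ge0_fin_numE// (le_lt_trans A1)// ltry.
apply/lee_addgt0Pr => e e0.
have e40 : (0 < e / 4)%R by rewrite divr_gt0.
have h := hellinger_lower e40.
rewrite -[X in X <= _]gapA [X in X <= _]addeC [X in _ <= X]addeCA leeD2lE// in h.
apply: (le_trans h).
by rewrite leeD2l// lee_fin; lra.
Qed.

Let e_ C x := \int[M x]_y (\1_C y * (1 - f (x, y)))%:E.
Let e'_ C x := \int[M' x]_y (\1_C y * f (x, y))%:E.

Let measurable_indic2 C : measurable C ->
  measurable_fun setT (fun u : X * Y => \1_C u.2 : R).
Proof.
move=> mC; have mi : measurable_fun setT (\1_C : Y -> R) by exact: measurable_indic.
exact: (measurableT_comp mi measurable_snd).
Qed.

Let me_ C : measurable C -> measurable_fun setT (e_ C).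
Proof.
move=> /measurable_indic2 mC.
have mF : measurable_fun setT (fun u => (\1_C u.2 * (1 - f u))%:E).
  by apply/measurable_EFinP; mreal.
by apply: (measurable_integral_kmod mM mF) => u; rewrite lee_fin; nneg.
Qed.

Let me'_ C : measurable C -> measurable_fun setT (e'_ C).
Proof.
move=> /measurable_indic2 mC.
have mF : measurable_fun setT (fun u => (\1_C u.2 * f u)%:E).
  by apply/measurable_EFinP; mreal.
by apply: (measurable_integral_kmod mM' mF) => u; rewrite lee_fin; nneg.
Qed.

Let e_ge0 C x : 0 <= e_ C x.
Proof. by apply: integral_ge0 => y _; rewrite lee_fin; nneg. Qed.

Let e'_ge0 C x : 0 <= e'_ C x.
Proof. by apply: integral_ge0 => y _; rewrite lee_fin; nneg. Qed.

(** Tested on every measurable [D], both integrals over [D] are those of [relPQ] on the rectangle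
    with sides [D] and [C]. The null set obtained depends on [C]. *)
Let eq_e C : measurable C -> ae_eq p setT (e_ C) (e'_ C).
Proof.
move=> mC; have mC2 := measurable_indic2 mC.
have fx x : measurable_fun setT (fun y => f (x, y)).
  by apply: (measurableT_comp mf); exact: pair1_measurable.
have mC1 : measurable_fun setT (\1_C : Y -> R) by exact: measurable_indic.
apply: integral_ae_eq => //.
- apply/integrableP; split; first exact: me_.
  apply: (@le_lt_trans _ _ 1); last exact: ltry.
  rewrite -[X in _ <= X](integral_cst_probability p).
  apply: ge0_le_integral => //; first by apply: measurableT_comp => //; exact: me_.
  move=> x _; rewrite gee0_abs// -[X in _ <= X](integral_cst_probability (M x)).
  have fx' := fx x.
  apply: ge0_le_integral_EFin => //; [by mreal|by nneg|].
  move=> y; rewrite indicE; case: (_ \in _); rewrite ?mul0r// mul1r.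
  by have := f0 (x, y); lra.
- exact: me'_.
- move=> D _ mD; rewrite integral_mkcond [RHS]integral_mkcond.
  have mD1 : measurable_fun setT (fun u : X * Y => \1_D u.1 : R).
    have mi : measurable_fun setT (\1_D : X -> R) by exact: measurable_indic.
    exact: (measurableT_comp mi measurable_fst).
  transitivity (\int[P]_u (\1_D u.1 * \1_C u.2 * (1 - f u))%:E).
    rewrite integralP; [|by apply/measurable_EFinP; mreal|by move=> u; rewrite lee_fin; nneg].
    apply: eq_integral => x _; rewrite patchE /= indicE; case: ifP => xD.
      by apply: eq_integral => y _; rewrite mul1r.
    by rewrite integral0_eq// => y _; rewrite !mul0r.
  rewrite (relPQ (F := fun u => (\1_D u.1 * \1_C u.2)%R)); [|by mreal|by nneg].
  rewrite integralQ; [|by apply/measurable_EFinP; mreal|by move=> u; rewrite lee_fin; nneg].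
  apply: eq_integral => x _; rewrite patchE /= indicE; case: ifP => xD.
    by apply: eq_integral => y _; rewrite mul1r.
  by rewrite integral0_eq// => y _; rewrite !mul0r.
Qed.

(** On active points [1 - f] times the law through [M] equals [f] times the law through [M']: by
    [eq_e] this holds on rectangles, the null set being harmless for [J] by assumption, and then
    everywhere. Multiplying by [g] gives the claim, as [w ^+ 2 <= g * f] and [g * (1 - f) <= 1]. *)
Let transfer d (H : measurableType d) (J : probability (H * X)%type R)
    (act : H -> bool) : measurable_fun setT act ->
  (forall N, measurable N -> p N = 0 -> J [set x | act x.1 /\ N x.2] = 0) ->
  forall F : (H * X) * Y -> \bar R, measurable_fun setT F ->
    (forall u, 0 <= F u) ->
  \int[J]_x (((act x.1)%:R)%:E *
     \int[M' x.2]_y (F (x, y) * (w (x.2, y) ^+ 2)%:E)) <=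
  \int[J]_x (((act x.1)%:R)%:E * \int[M x.2]_y F (x, y)).
Proof.
move=> mact actN F mF F0.
pose a := kprob (kpair (kcst (X := unit) J) (ksnd (W := H) (kmod mM))) tt.
pose b := kprob (kpair (kcst (X := unit) J) (ksnd (W := H) (kmod mM'))) tt.
have aE G : measurable_fun setT G -> (forall u, 0 <= G u) ->
  \int[a]_u G u = \int[J]_x \int[M x.2]_y G (x, y).
  by move=> mG G0; rewrite [LHS]integral_kpair.
have bE G : measurable_fun setT G -> (forall u, 0 <= G u) ->
  \int[b]_u G u = \int[J]_x \int[M' x.2]_y G (x, y).
  by move=> mG G0; rewrite [LHS]integral_kpair.
have msnd : measurable_fun setT (fun u : (H * X) * Y => (u.1.2, u.2)).
  apply/measurable_fun_pairP; split => /=.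
    exact: (measurableT_comp measurable_snd measurable_fst).
  exact: measurable_snd.
have mact2 : measurable_fun setT (fun u : (H * X) * Y => act u.1.1).
  apply: (measurableT_comp mact).
  exact: (measurableT_comp measurable_fst measurable_fst).
have mact1 : measurable_fun setT (fun x : H * X => act x.1).
  exact: (measurableT_comp mact measurable_fst).
have mf2 : measurable_fun setT (fun u : (H * X) * Y => f (u.1.2, u.2)).
  exact: (measurableT_comp mf msnd).
have mg2 : measurable_fun setT (fun u : (H * X) * Y => g (u.1.2, u.2)).
  exact: (measurableT_comp mg msnd).
have mw2 : measurable_fun setT (fun u : (H * X) * Y => w (u.1.2, u.2)).
  exact: (measurableT_comp mw msnd).
pose ga (u : (H * X) * Y) : R := if act u.1.1 then (1 - f (u.1.2, u.2))%R else 0%R.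
pose hb (u : (H * X) * Y) : R := if act u.1.1 then f (u.1.2, u.2) else 0%R.
have mga : measurable_fun setT ga by rewrite /ga; mreal.
have mhb : measurable_fun setT hb by rewrite /hb; mreal.
have ga01 u : (0 <= ga u <= 1)%R.
  by rewrite /ga; case: ifP => // _; [rewrite f1 gerBl f0|rewrite lexx ler01].
have hb01 u : (0 <= hb u <= 1)%R.
  by rewrite /hb; case: ifP => // _; rewrite lexx ler01.
have ga0 u : (0 <= ga u)%R by have /andP[] := ga01 u.
have hb0 u : (0 <= hb u)%R by have /andP[] := hb01 u.
have rect E C : measurable E -> measurable C ->
    \int[a]_(x in E `*` C) (ga x)%:E = \int[b]_(x in E `*` C) (hb x)%:E.
  move=> mE mC.
  have mEi : measurable_fun setT (\1_E : H * X -> R) by exact: measurable_indic.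
  have mCi : measurable_fun setT (\1_C : Y -> R) by exact: measurable_indic.
  have mE2 : measurable_fun setT (fun u : (H * X) * Y => \1_E u.1 : R).
    exact: (measurableT_comp mEi measurable_fst).
  have mC2 : measurable_fun setT (fun u : (H * X) * Y => \1_C u.2 : R).
    exact: (measurableT_comp mCi measurable_snd).
  have patchX (k : (H * X) * Y -> R) u :
      ((EFin \o k) \_ (E `*` C)) u = (\1_E u.1 * \1_C u.2 * k u)%:E.
    rewrite patchE /= !indicE in_setX.
    by case: (_ \in _); case: (_ \in _) => /=; rewrite ?mul0r ?mul1r ?mul0r.
  rewrite integral_mkcond [RHS]integral_mkcond.
  under eq_integral do rewrite (patchX ga).
  under [RHS]eq_integral do rewrite (patchX hb).
  rewrite aE; [|by apply/measurable_EFinP; mreal|by move=> u; rewrite lee_fin; nneg].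
  rewrite bE; [|by apply/measurable_EFinP; mreal|by move=> u; rewrite lee_fin; nneg].
  have fx x : measurable_fun setT (fun y => f (x, y)).
    by apply: (measurableT_comp mf); exact: pair1_measurable.
  pose k (x : H * X) : R := (\1_E x * (if act x.1 then 1 else 0))%R.
  have k0 x : (0 <= k x)%R by rewrite /k indicE; case: ifP => _; nneg.
  have mk : measurable_fun setT k by rewrite /k; mreal.
  have ->: \int[J]_x \int[M x.2]_y (\1_E x * \1_C y * ga (x, y))%:E =
      \int[J]_x ((k x)%:E * e_ C x.2).
    apply: eq_integral => x _; have fx' := fx x.2.
    rewrite -(@ge0_integralZ_EFin _ _ _ (M x.2) (k x)
      (fun y => \1_C y * (1 - f (x.2, y)))%R)//; [|by mreal|by nneg].
    apply: eq_integral => y _; congr EFin; rewrite /k /ga /=.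
    by case: ifP => _; ring.
  have ->: \int[J]_x \int[M' x.2]_y (\1_E x * \1_C y * hb (x, y))%:E =
      \int[J]_x ((k x)%:E * e'_ C x.2).
    apply: eq_integral => x _; have fx' := fx x.2.
    rewrite -(@ge0_integralZ_EFin _ _ _ (M' x.2) (k x)
      (fun y => \1_C y * f (x.2, y))%R)//; [|by mreal|by nneg].
    apply: eq_integral => y _; congr EFin; rewrite /k /hb /=.
    by case: ifP => _; ring.
  have mkE : measurable_fun setT (EFin \o k) by exact/measurable_EFinP.
  have [N [mN pN eN]] := eq_e mC.
  apply: ge0_ae_eq_integral => //.
  - by apply: emeasurable_funM => //; apply: (measurableT_comp (me_ mC)).
  - by apply: emeasurable_funM => //; apply: (measurableT_comp (me'_ mC)).
  - by move=> x _; apply: mule_ge0; rewrite ?lee_fin.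
  - by move=> x _; apply: mule_ge0; rewrite ?lee_fin.
  exists [set x | act x.1 /\ N x.2]; split => //.
  - have -> : [set x : H * X | act x.1 /\ N x.2] =
        (fun x : H * X => act x.1) @^-1` [set true] `&` snd @^-1` N by [].
    apply: measurableI; rewrite -[X in measurable X]setTI; first exact: mact1.
    exact: measurable_snd.
  - exact: actN.
  - move=> x /= Hx; have [ax|ax] := boolP (act x.1); last first.
      by exfalso; apply: Hx => _; rewrite /k (negbTE ax) mulr0 !mul0e.
    split=> //; apply: eN => /= He; apply: Hx => _.
    by rewrite He.
pose F' u := F u * (g (u.1.2, u.2))%:E.
have mF' : measurable_fun setT F'.
  by apply: emeasurable_funM => //; exact/measurable_EFinP.
have F'0 u : 0 <= F' u by rewrite mule_ge0// lee_fin.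
have key := eq_density_on_rectangles mga mhb ga01 hb01 rect mF' F'0.
have mgaE : measurable_fun setT (EFin \o ga) by exact/measurable_EFinP.
have mhbE : measurable_fun setT (EFin \o hb) by exact/measurable_EFinP.
have mactR : measurable_fun setT (fun x : H * X => ((act x.1)%:R : R)%:E).
  apply/measurable_EFinP.
  rewrite (_ : (fun x => _) = fun x : H * X => if act x.1 then 1%R else 0%R).
    by mreal.
  by apply/funext => x; case: (act x.1).
have mactR2 : measurable_fun setT (fun u : (H * X) * Y => ((act u.1.1)%:R : R)%:E).
  exact: (measurableT_comp mactR measurable_fst).
have act0 (x : bool) : 0 <= ((x)%:R : R)%:E by rewrite lee_fin.
have left_le : \int[J]_x (((act x.1)%:R)%:E *
     \int[M' x.2]_y (F (x, y) * (w (x.2, y) ^+ 2)%:E)) <= \int[b]_u (F' u * (hb u)%:E).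
  rewrite bE; [|by apply: emeasurable_funM|by move=> u; rewrite mule_ge0 ?lee_fin].
  apply: ge0_le_lower_integral.
    move=> x; apply: mule_ge0 => //; apply: integral_ge0 => y _.
    by rewrite mule_ge0// lee_fin sqr_ge0.
  move=> x; case ax: (act x.1); last first.
    rewrite mul0e; apply: integral_ge0 => y _.
    by rewrite mule_ge0// lee_fin.
  rewrite mul1e; apply: ge0_le_lower_integral => y.
    by rewrite mule_ge0// lee_fin sqr_ge0.
  by rewrite /F' /hb /= ax -muleA -EFinM lee_wpmul2l// lee_fin.
apply: (le_trans left_le); rewrite -key.
rewrite aE; [|by apply: emeasurable_funM|by move=> u; rewrite mule_ge0 ?lee_fin].
apply: ge0_le_lower_integral.
  by move=> x; apply: integral_ge0 => y _; rewrite mule_ge0// lee_fin.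
move=> x; case ax: (act x.1); last first.
  by rewrite mul0e integral0_eq// => y _; rewrite /ga /= ax mule0.
rewrite mul1e; apply: ge0_le_lower_integral => y.
  by rewrite mule_ge0// lee_fin.
rewrite /F' /ga /= ax -muleA -EFinM -[X in _ <= X]mule1 lee_wpmul2l//.
by rewrite lee_fin.
Qed.

Lemma joint_density_with : exists w, likelihood_root w.
Proof. by exists w; split. Qed.

End with_density.

Lemma joint_density : exists w, likelihood_root w.
Proof.
by have [f [mf f01 PE QE _]] := hellinger_density P Q; exact: joint_density_with PE QE.
Qed.

End joint_density.

(** * Laws of histories and stopping *)

Section kif.
Local Open Scope ereal_scope.
Context (R : realType) d1 d2 (X : measurableType d1) (Y : measurableType d2).
Variables (b : X -> bool) (k1 k2 : R.-pker X ~> Y).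

Definition kif (mb : measurable_fun setT b) : X -> {measure set Y -> \bar R} :=
  fun x => if b x then k1 x else k2 x.

Hypothesis mb : measurable_fun setT b.

Let measurable_kif U : measurable U -> measurable_fun setT (kif mb ^~ U).
Proof.
move=> mU; rewrite (_ : (kif mb)^~ U = fun x => if b x then k1 x U else k2 x U).
  by apply: measurable_fun_ifT => //; exact: measurable_kernel.
by apply/funext => x; rewrite /kif; case: ifP.
Qed.

HB.instance Definition _ := isKernel.Build _ _ _ _ _ (kif mb) measurable_kif.

Let kifT x : kif mb x setT = 1.
Proof. by rewrite /kif; case: ifP => _; exact: prob_kernel. Qed.

HB.instance Definition _ := Kernel_isProbability.Build _ _ _ _ _ (kif mb) kifT.

Lemma integral_kif x (F : Y -> \bar R) : \int[kif mb x]_y F y =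
  if b x then \int[k1 x]_y F y else \int[k2 x]_y F y.
Proof.
have -> : kif mb x = if b x then k1 x else k2 x by [].
by case: (b x).
Qed.

End kif.

Section history_law.
Local Open Scope ereal_scope.
Context (R : realType) d1 d2 (Pi : measurableType d1) (O : measurableType d2).
Variables (alg : algorithm R Pi O).
Notation hist := (hist R Pi O).

Lemma measurable_hist_fst t d (Y : measurableType d) (F : hist t -> Y) :
  measurable_fun setT F -> measurable_fun setT (fun h : hist t.+1 => F h.1).
Proof. by move=> mF; exact: (measurableT_comp mF measurable_fst). Qed.

Lemma measurable_hist_snd t d (Y : measurableType d)
    (F : (Pi * (R * O))%type -> Y) :
  measurable_fun setT F -> measurable_fun setT (fun h : hist t.+1 => F h.2).
Proof. by move=> mF; exact: (measurableT_comp mF measurable_snd). Qed.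

Section one_model.
Variable M : model R Pi O.
Hypothesis mM : forall A, measurable A -> measurable_fun setT (fun pi => M pi A).

(** The iterated integral [Ehist] as integration against a genuine probability, see [EhistE]. *)
Fixpoint law (t : nat) : probability (hist t) R :=
  match t with
  | 0 => \d_tt
  | t'.+1 => kprob (kpair (kcst (X := unit) (law t'))
                          (kpair (alg t') (kmod mM))) tt
  end.

Lemma integral_lawS t (F : hist t.+1 -> \bar R) : measurable_fun setT F ->
  (forall h, 0 <= F h) ->
  \int[law t.+1]_h F h =
  \int[law t]_h \int[alg t h]_pi \int[M pi]_z F (h, (pi, z)).
Proof.
move=> mF F0; rewrite [LHS]integral_kpair//.
apply: eq_integral => h _; rewrite [LHS]integral_kpair//.
exact: (measurableT_comp mF (pair1_measurable h)).
Qed.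

Lemma measurable_step t (F : hist t.+1 -> \bar R) : measurable_fun setT F ->
  (forall h, 0 <= F h) ->
  measurable_fun setT
    (fun h : hist t => \int[alg t h]_pi \int[M pi]_z F (h, (pi, z))).
Proof.
move=> mF F0; have := measurable_fun_integral_finite_kernel F (kpair (alg t) (kmod mM)) F0 mF.
rewrite (_ : (fun h => _) =
  (fun h : hist t => \int[alg t h]_pi \int[M pi]_z F (h, (pi, z))))//.
apply/funext => h; rewrite [LHS]integral_kpair//.
exact: (measurableT_comp mF (pair1_measurable h)).
Qed.

Lemma EhistE t (F : hist t -> \bar R) : measurable_fun setT F ->
  (forall h, 0 <= F h) -> Ehist alg M F = \int[law t]_h F h.
Proof.
elim: t F => [|t IH] F mF F0.
  by rewrite /= integral_dirac// diracT mul1e.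
rewrite integral_lawS//= IH//; first exact: measurable_step.
by move=> h; apply: integral_ge0 => pi _; apply: integral_ge0.
Qed.

Lemma integral_law_fst t (F : hist t -> \bar R) : measurable_fun setT F ->
  (forall h, 0 <= F h) ->
  \int[law t.+1]_h F h.1 = \int[law t]_h F h.
Proof.
move=> mF F0; rewrite (integral_lawS (F := F \o fst))//=; last first.
  exact: (measurableT_comp mF measurable_fst).
apply: eq_integral => h _.
under eq_integral do rewrite integral_cst_probability.
by rewrite integral_cst_prob// prob_kernel.
Qed.

End one_model.

Definition avg t (u : Pi -> R) (h : hist t) : R :=
  fine (\int[alg t h]_pi (u pi)%:E).

Section avg.
Variables (u : Pi -> R) (c : R).
Hypotheses (mu : measurable_fun setT u) (u0 : forall pi, (0 <= u pi)%R).
Hypothesis uc : forall pi, (u pi <= c)%R.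

Let int_ge0 t (h : hist t) : 0 <= \int[alg t h]_pi (u pi)%:E.
Proof. by apply: integral_ge0 => pi _; rewrite lee_fin. Qed.

Let int_le t (h : hist t) : \int[alg t h]_pi (u pi)%:E <= c%:E.
Proof.
rewrite -[X in _ <= X](@integral_cst_prob _ _ _ (alg t h)) ?prob_kernel//.
by apply: ge0_le_integral_EFin.
Qed.

Lemma avgE t (h : hist t) : (avg u h)%:E = \int[alg t h]_pi (u pi)%:E.
Proof. by rewrite /avg fineK// ge0_fin_numE// (le_lt_trans (int_le h))// ltry. Qed.

Lemma avg_ge0 t (h : hist t) : (0 <= avg u h)%R.
Proof. by rewrite -lee_fin avgE. Qed.

Lemma avg_le t (h : hist t) : (avg u h <= c)%R.
Proof. by rewrite -lee_fin avgE. Qed.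

Lemma measurable_avg t : measurable_fun setT (@avg t u).
Proof.
apply: measurableT_comp => //.
apply: measurable_fun_integral_kernel => //.
- by move=> U mU; exact: measurable_kernel.
- exact/measurable_EFinP.
Qed.

End avg.

(** * Stopping on the accumulated gap, and the averaged play *)

Section stopping.
Variables (gb : Pi -> R) (th : R).
Hypotheses (mgb : measurable_fun setT gb) (gb0 : forall pi, (0 <= gb pi)%R).
Hypothesis gb1 : forall pi, (gb pi <= 1)%R.

(** This is [acc gb], by [acc_cumgap]; it has to come first because [active], on which [acc]
    depends, is defined from it. It sums conditional means, so whether round [t + 1] is active is
    decided by the history up to [t]. *)
Fixpoint cumgap (t : nat) : hist t -> R :=
  match t with
  | 0 => fun _ => 0%R
  | t'.+1 => fun h =>
      (cumgap h.1 + (if cumgap h.1 <= th then avg gb h.1 else 0))%R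
  end.

Definition active t (h : hist t) : bool := (cumgap h <= th)%R.

Fixpoint acc (u : Pi -> R) (t : nat) : hist t -> R :=
  match t with
  | 0 => fun _ => 0%R
  | t'.+1 => fun h => (acc u h.1 + (if active h.1 then avg u h.1 else 0))%R
  end.

Lemma acc_cumgap t (h : hist t) : acc gb h = cumgap h.
Proof. by elim: t h => // t IH h /=; rewrite IH. Qed.

Lemma measurable_cumgap t : measurable_fun setT (@cumgap t).
Proof.
elim: t => [|t IH]; first exact: measurable_cst.
have mZ : measurable_fun setT (fun h : hist t.+1 => cumgap h.1).
  exact: (measurable_hist_fst IH).
have mi : measurable_fun setT (fun h : hist t => if (cumgap h <= th)%R then avg gb h else 0%R).
  by have ma := @measurable_avg gb mgb gb0 t; mreal.
have mi' := measurable_hist_fst mi.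
exact: measurable_funD.
Qed.

Lemma measurable_active t : measurable_fun setT (@active t).
Proof. by apply: measurable_fun_ler; [exact: measurable_cumgap|mreal]. Qed.

(** The sum freezes once above [th], and the last increment is at most 1. *)
Lemma cumgap_le t (h : hist t) : (0 <= th -> cumgap h <= th + 1)%R.
Proof.
move=> th0; elim: t h => [h|t IH h] /=; first by rewrite addr_ge0.
case: ifP => [le_th|_]; last by rewrite addr0.
by rewrite lerD// (avg_le mgb gb0 gb1).
Qed.

Lemma active_prev t (h : hist t.+1) : active h -> active h.1.
Proof.
by rewrite /active /=; case: ifP => // nle; rewrite addr0 nle.
Qed.

Section acc.
Variables (u : Pi -> R) (c : R).
Hypotheses (mu : measurable_fun setT u) (u0 : forall pi, (0 <= u pi)%R).
Hypothesis uc : forall pi, (u pi <= c)%R.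

Lemma measurable_inc t :
  measurable_fun setT (fun h : hist t => if active h then avg u h else 0%R).
Proof.
have := @measurable_active t; have := @measurable_avg u mu u0 t => *; mreal.
Qed.

Lemma inc_ge0 t (h : hist t) : (0 <= if active h then avg u h else 0)%R.
Proof. by case: ifP => // _; exact: (avg_ge0 mu u0 uc). Qed.

Lemma measurable_acc t : measurable_fun setT (@acc u t).
Proof.
elim: t => [|t IH]; first exact: measurable_cst.
have mZ : measurable_fun setT (fun h : hist t.+1 => acc u h.1).
  exact: (measurable_hist_fst IH).
have ma := measurable_hist_fst (@measurable_inc t).
exact: measurable_funD.
Qed.

Lemma acc_ge0 t (h : hist t) : (0 <= acc u h)%R.
Proof. by elim: t h => // t IH h /=; rewrite addr_ge0// inc_ge0. Qed.

Lemma integral_acc (M : model R Pi O)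
    (mM : forall A, measurable A -> measurable_fun setT (fun pi => M pi A)) t :
  \int[law mM t]_h (acc u h)%:E =
  \sum_(s < t) \int[law mM s]_h (if active h then avg u h else 0%R)%:E.
Proof.
elim: t => [|t IH]; first by rewrite big_ord0 integral0_eq.
rewrite big_ord_recr -IH /=.
have ma := @measurable_acc t; have mi := @measurable_inc t.
rewrite (integral_law_fst mM (F := fun h =>
  (acc u h + (if active h then avg u h else 0))%:E)); last 2 first.
- by apply/measurable_EFinP; exact: measurable_funD.
- by move=> h; rewrite lee_fin addr_ge0 ?acc_ge0 ?inc_ge0.
by rewrite ge0_integralD_EFin//; [exact: acc_ge0|exact: inc_ge0].
Qed.

End acc.

(* The decision distribution tested against the DEC: the average play under the
   base model, where the algorithm is overridden by [pi0] once it has paid [th]. *)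
Section play.
Variable Mb : model R Pi O.
Hypothesis mMb : forall A, measurable A -> measurable_fun setT (fun pi => Mb pi A).
Variables (pi0 : Pi) (n : nat).
Notation T := n.+1.

Definition stopped_alg t : R.-pker hist t ~> Pi :=
  kif (alg t) (kcst (\d_pi0 : probability Pi R)) (@measurable_active t).

Definition play_at t : {measure set Pi -> \bar R} :=
  mkcomp (kcst (X := unit) (law mMb t)) (ksnd (W := unit) (stopped_alg t)) tt.

Definition play := mscale ((T%:R^-1 : R)%:nng)%R (msum play_at T).

HB.instance Definition _ := Measure.on play.

Lemma integral_play_at t (u : Pi -> \bar R) : measurable_fun setT u ->
  (forall pi, 0 <= u pi) ->
  \int[play_at t]_pi u pi = \int[law mMb t]_h \int[stopped_alg t h]_pi u pi.
Proof. by move=> mu u0; rewrite [LHS]integral_kcomp. Qed.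

Lemma integral_play (u : Pi -> \bar R) : measurable_fun setT u ->
  (forall pi, 0 <= u pi) ->
  T%:R%:E * \int[play]_pi u pi =
  \sum_(t < T) \int[law mMb t]_h \int[stopped_alg t h]_pi u pi.
Proof.
move=> mu u0; rewrite ge0_integral_mscale// ge0_integral_measure_sum//=.
rewrite muleA -EFinM mulfV ?mul1e ?pnatr_eq0//.
by apply: eq_bigr => t _; rewrite integral_play_at.
Qed.

Let playT : play setT = 1.
Proof.
have e : \int[play]_pi (cst 1 pi) = play setT by rewrite integral_cst// mul1e.
have := integral_play (measurable_cst (1 : \bar R)) (fun=> lee01).
rewrite e => /(congr1 (fun x => (T%:R^-1)%:E * x)).
rewrite muleA -EFinM mulVf ?mul1e ?pnatr_eq0// => ->.
rewrite (eq_bigr (fun=> 1)).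
  by rewrite sumEFin sumr_const card_ord -EFinM mulVf ?pnatr_eq0.
move=> t _; under eq_integral do rewrite integral_cst_prob ?prob_kernel//.
exact: integral_cst_probability.
Qed.

HB.instance Definition _ := Measure_isProbability.Build _ _ _ play playT.

End play.
End stopping.
End history_law.

(** * The likelihood process *)

Section likelihood.
Local Open Scope ereal_scope.
Context (R : realType) d1 d2 (Pi : measurableType d1) (O : measurableType d2).
Variables (alg : algorithm R Pi O) (Mb : model R Pi O).
Hypothesis mMb : forall A, measurable A -> measurable_fun setT (fun pi => Mb pi A).
Variables (gb : Pi -> R) (th : R).
Hypotheses (mgb : measurable_fun setT gb) (gb0 : forall pi, (0 <= gb pi)%R).
Hypothesis gb1 : forall pi, (gb pi <= 1)%R.
Variables (pi0 : Pi) (n : nat).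
Notation T := n.+1.
Notation hist := (hist R Pi O).
Notation p := (play alg th mgb gb0 mMb pi0 n).
Notation lawb := (law alg mMb).
Notation act := (active alg gb th).
Notation acc := (acc alg gb th).
Notation avg := (avg alg).

Lemma integral_stopped_alg (u : Pi -> R) c t (h : hist t) :
  measurable_fun setT u -> (forall pi, 0 <= u pi)%R -> (forall pi, u pi <= c)%R ->
  \int[stopped_alg alg th mgb gb0 pi0 t h]_pi (u pi)%:E =
  (if act h then avg u h else u pi0)%:E.
Proof.
move=> mu u0 uc; rewrite [LHS]integral_kif; case: ifP => _.
  by rewrite (avgE alg mu u0 uc).
by rewrite integral_dirac// ?diracT ?mul1e//; exact/measurable_EFinP.
Qed.

(** The overridden rounds contribute [u pi0 >= 0] to the right side and nothing to the left. *)
Lemma acc_le_play (u : Pi -> R) c :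
  measurable_fun setT u -> (forall pi, 0 <= u pi)%R -> (forall pi, u pi <= c)%R ->
  \int[lawb T]_h (acc u h)%:E <= T%:R%:E * \int[p]_pi (u pi)%:E.
Proof.
move=> mu u0 uc; rewrite (integral_acc alg th mgb gb0 mu u0 uc).
rewrite integral_play//; last exact/measurable_EFinP.
apply: lee_sum => t _.
apply: ge0_le_lower_integral.
  by move=> h; rewrite lee_fin; exact: (inc_ge0 alg gb th mu u0 uc).
move=> h; rewrite (integral_stopped_alg _ mu u0 uc) lee_fin.
by case: ifP.
Qed.

(** Active rounds pay at most [th + 1] altogether, and each overridden round pays [gb pi0]. *)
Lemma play_gap_le : (0 <= th)%R ->
  T%:R%:E * \int[p]_pi (gb pi)%:E <= (th + 1 + T%:R * gb pi0)%:E.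
Proof.
move=> th0; rewrite integral_play//; last exact/measurable_EFinP.
apply: (@le_trans _ _ (\sum_(t < T) (\int[lawb t]_h
    (if act h then avg gb h else 0%R)%:E + (gb pi0)%:E))).
  apply: lee_sum => t _.
  have mi := measurable_inc alg th mgb gb0 mgb gb0 (t := t).
  rewrite -[X in _ <= _ + X](integral_cst_probability (lawb t)) -ge0_integralD_EFin//; last first.
    by move=> h; exact: (inc_ge0 alg gb th mgb gb0 gb1).
  apply: ge0_le_lower_integral.
    by move=> h; apply: integral_ge0 => pi _; rewrite lee_fin.
  move=> h; rewrite (integral_stopped_alg _ mgb gb0 gb1) lee_fin.
  by case: ifP => _; rewrite ?lerDl ?add0r.
rewrite big_split/= -(integral_acc alg th mgb gb0 mgb gb0 gb1) EFinD leeD//.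
  apply: (@le_trans _ _ (\int[lawb T]_h (th + 1)%:E)).
    apply: ge0_le_lower_integral => h; rewrite lee_fin.
      exact: (acc_ge0 alg gb th mgb gb0 gb1).
    by rewrite acc_cumgap (cumgap_le alg mgb gb0 gb1).
  by rewrite integral_cst_probability.
by rewrite sumEFin sumr_const card_ord mulr_natl.
Qed.

Definition joint t : probability (hist t * Pi)%type R :=
  kprob (kpair (kcst (X := unit) (lawb t)) (alg t)) tt.

Lemma integral_joint t (F : hist t * Pi -> \bar R) : measurable_fun setT F ->
  (forall x, 0 <= F x) ->
  \int[joint t]_x F x = \int[lawb t]_h \int[alg t h]_pi F (h, pi).
Proof. by move=> mF F0; rewrite [LHS]integral_kpair. Qed.

(** The active part of the decision at round [t] is one of the [T] terms averaged in [p], hence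
    dominated by it. This is the condition under which the likelihood ratio may be transferred. *)
Lemma joint_null t N : (t < T)%N -> measurable N -> p N = 0 ->
  joint t [set x | act x.1 /\ N x.2] = 0.
Proof.
move=> tT mN pN.
have mact := measurable_active alg th mgb gb0 (t := t).
have mS : measurable [set x : hist t * Pi | act x.1 /\ N x.2].
  have -> : [set x : hist t * Pi | act x.1 /\ N x.2] =
      (fun x => act x.1) @^-1` [set true] `&` snd @^-1` N by [].
  apply: measurableI; rewrite -[X in measurable X]setTI.
    by apply: (measurableT_comp mact measurable_fst).
  exact: measurable_snd.
have mNi : measurable_fun setT (\1_N : Pi -> R) by exact: measurable_indic.
have pN0 : \int[p]_pi (\1_N pi)%:E = 0 by rewrite integral_indic// setIT.
have mNE : measurable_fun setT (fun pi => (\1_N pi : R)%:E) by exact/measurable_EFinP.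
have N0 pi : 0 <= (\1_N pi : R)%:E by rewrite lee_fin.
have sum0 := integral_play alg th mgb gb0 mMb pi0 n mNE N0.
rewrite pN0 mule0 in sum0.
have ge0 s : 0 <= \int[lawb s]_h \int[stopped_alg alg th mgb gb0 pi0 s h]_pi (\1_N pi)%:E.
  by apply: integral_ge0 => h _; exact: integral_ge0.
apply/eqP; rewrite eq_le measure_ge0 andbT.
apply: (@le_trans _ _ (\int[lawb t]_h \int[stopped_alg alg th mgb gb0 pi0 t h]_pi (\1_N pi)%:E)).
  have -> : joint t [set x | act x.1 /\ N x.2] =
      \int[joint t]_x (\1_[set x | act x.1 /\ N x.2] x)%:E.
    by rewrite integral_indic// setIT.
  rewrite integral_joint//; last first.
    by apply/measurable_EFinP; exact: measurable_indic.
  apply: ge0_le_lower_integral => h; first by apply: integral_ge0 => pi _; rewrite lee_fin.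
  rewrite [leRHS]integral_kif; case: ifPn => ah.
    apply: ge0_le_lower_integral => pi; first by rewrite lee_fin.
    rewrite lee_fin !indicE; case: (boolP (_ \in [set x | _])) => //.
    by rewrite inE/= => -[_ Npi]; rewrite mem_set.
  rewrite integral0_eq; first exact: integral_ge0.
  move=> pi _; rewrite indicE memNset//= => -[ah' _].
  by rewrite ah' in ah.
rewrite [leRHS]sum0 (bigD1 (Ordinal tT))//= leeDl//.
by apply: sume_ge0 => s _; exact: ge0.
Qed.

(** * The stopped product of likelihood roots *)

Section process.
Variables (M : model R Pi O) (w : (Pi * (R * O))%type -> R) (kap : R).
Hypothesis mM : forall A, measurable A -> measurable_fun setT (fun pi => M pi A).
Hypotheses (mw : measurable_fun setT w) (w0 : forall u, (0 <= w u)%R).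
Hypothesis w2 : forall pi, \int[Mb pi]_z (w (pi, z) ^+ 2)%:E <= 1.
Hypothesis w_transfer :
  forall d (H : measurableType d) (J : probability (H * Pi)%type R)
      (a : H -> bool), measurable_fun setT a ->
    (forall N, measurable N -> p N = 0 -> J [set x | a x.1 /\ N x.2] = 0) ->
    forall F : (H * Pi) * (R * O) -> \bar R, measurable_fun setT F ->
    (forall u, 0 <= F u) ->
    \int[J]_x (((a x.1)%:R)%:E *
      \int[Mb x.2]_y (F (x, y) * (w (x.2, y) ^+ 2)%:E)) <=
    \int[J]_x (((a x.1)%:R)%:E * \int[M x.2]_y F (x, y)).
Hypotheses (kap0 : (0 <= kap)%R) (kap1 : (kap <= 1)%R).
Notation lawm := (law alg mM).

(** The measurable stand-in for the squared Hellinger distance: for the [w] of [joint_density], its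
    mean under [p] is at most the integral that the DEC constrains. *)
Definition affinity_gap (pi : Pi) : R :=
  (2 - 2 * fine (\int[Mb pi]_z (w (pi, z))%:E))%R.
Notation G := affinity_gap.

Let mwx pi : measurable_fun setT (fun z => w (pi, z)).
Proof. by apply: (measurableT_comp mw); exact: pair1_measurable. Qed.

Let int_w_ge0 pi : 0 <= \int[Mb pi]_z (w (pi, z))%:E.
Proof. by apply: integral_ge0 => z _; rewrite lee_fin. Qed.

Let int_w_le1 pi : \int[Mb pi]_z (w (pi, z))%:E <= 1.
Proof. exact: integral_le1_of_sq. Qed.

Let int_wE pi : \int[Mb pi]_z (w (pi, z))%:E = (1 - G pi / 2)%:E.
Proof.
rewrite -[LHS]fineK; last first.
  by rewrite ge0_fin_numE// (le_lt_trans (int_w_le1 pi))// ltry.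
by congr EFin; rewrite /G; field.
Qed.

Let mint_w : measurable_fun setT (fun pi => \int[Mb pi]_z (w (pi, z))%:E).
Proof.
have mwE : measurable_fun setT (EFin \o w) by exact/measurable_EFinP.
by apply: (measurable_integral_kmod mMb mwE) => u; rewrite lee_fin.
Qed.

Lemma measurable_gap : measurable_fun setT G.
Proof.
have mf : measurable_fun setT (fun pi => fine (\int[Mb pi]_z (w (pi, z))%:E)).
  exact: measurableT_comp.
by rewrite /G; mreal.
Qed.

Lemma gap_ge0 pi : (0 <= G pi)%R.
Proof. by have := int_w_le1 pi; rewrite int_wE lee_fin; lra. Qed.

Lemma gap_le2 pi : (G pi <= 2)%R.
Proof. by have := int_w_ge0 pi; rewrite int_wE lee_fin; lra. Qed.

Let avgG0 t (h : hist t) : (0 <= avg G h)%R.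
Proof. exact: (avg_ge0 alg measurable_gap gap_ge0 gap_le2). Qed.

Let avg_w t (h : hist t) :
  \int[alg t h]_pi \int[Mb pi]_z (w (pi, z))%:E = (1 - avg G h / 2)%:E.
Proof.
have mG := measurable_gap.
under eq_integral do rewrite int_wE.
have v0 pi : (0 <= 1 - G pi / 2)%R by have := gap_le2 pi; lra.
have g0 pi : (0 <= 2^-1 * G pi)%R by rewrite mulr_ge0// gap_ge0.
have e : \int[alg t h]_pi (1 - G pi / 2)%:E + (avg G h / 2)%:E = 1.
  rewrite [(avg G h / 2)%R]mulrC EFinM (avgE alg mG gap_ge0 gap_le2).
  rewrite -ge0_integralZ_EFin//; last exact: gap_ge0.
  rewrite -ge0_integralD_EFin//; try solve [mreal].
  under eq_integral do rewrite mulrC subrK.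
  by rewrite integral_cst_prob// prob_kernel.
by rewrite EFinB -e addeK.
Qed.

(** The test includes the increment of the coming round, which is known before that round is played;
    thus factors [w] enter only while the budget stays within [kap]. *)
Definition used t (h : hist t) : bool :=
  act h && (acc G h + avg G h <= kap)%R.

Fixpoint lik (t : nat) : hist t -> R :=
  match t with
  | 0 => fun _ => 1%R
  | t'.+1 => fun h => (lik h.1 * (if used h.1 then w h.2 else 1))%R
  end.

Lemma measurable_used t : measurable_fun setT (@used t).
Proof.
have ma := measurable_active alg th mgb gb0 (t := t).
have mK := measurable_acc alg th mgb gb0 measurable_gap gap_ge0 (t := t).
have mA := measurable_avg alg measurable_gap gap_ge0 (t := t).
by apply: measurable_and => //; mreal.
Qed.

Lemma measurable_lik t : measurable_fun setT (@lik t).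
Proof.
elim: t => [|t IH]; first exact: measurable_cst.
have m1 := measurable_hist_fst IH.
have m2 := measurable_hist_fst (@measurable_used t).
have m3 := @measurable_hist_snd _ _ _ Pi O t _ _ w mw.
by apply: measurable_funM => //; apply: measurable_fun_ifT => //; mreal.
Qed.

Lemma lik_ge0 t (h : hist t) : (0 <= lik h)%R.
Proof. by elim: t h => // t IH h /=; rewrite mulr_ge0//; case: ifP. Qed.

Let w2_alg t (h : hist t) :
  \int[alg t h]_pi \int[Mb pi]_z (w (pi, z) ^+ 2)%:E <= 1.
Proof.
rewrite -[X in _ <= X](@integral_cst_prob _ _ _ (alg t h)) ?prob_kernel//.
apply: ge0_le_lower_integral => // pi.
by apply: integral_ge0 => z _; rewrite lee_fin sqr_ge0.
Qed.

Let pull t (h : hist t) (c : R) (v : (Pi * (R * O))%type -> R) :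
  measurable_fun setT v -> (forall u, 0 <= v u)%R -> (0 <= c)%R ->
  \int[alg t h]_pi \int[Mb pi]_z (c * v (pi, z))%:E =
  c%:E * \int[alg t h]_pi \int[Mb pi]_z (v (pi, z))%:E.
Proof.
move=> mv v0 c0.
have vx pi : measurable_fun setT (fun z => v (pi, z)).
  by apply: (measurableT_comp mv); exact: pair1_measurable.
have mvE : measurable_fun setT (EFin \o v) by exact/measurable_EFinP.
rewrite -ge0_integralZl//; last 2 first.
- by apply: (measurable_integral_kmod mMb mvE) => u; rewrite lee_fin.
- by move=> pi _; apply: integral_ge0 => z _; rewrite lee_fin.
apply: eq_integral => pi _.
exact: (@ge0_integralZ_EFin _ _ _ (Mb pi) c (fun z => v (pi, z))).
Qed.

(** Given the past, a used round multiplies [lik ^+ 2] by a factor of mean at most 1, and other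
    rounds leave it alone; [F] depends on the past only. *)
Lemma lik_sq_super t (F : hist t -> R) : measurable_fun setT F ->
  (forall h, 0 <= F h)%R ->
  \int[lawb t.+1]_h (lik h ^+ 2 * F h.1)%:E <= \int[lawb t]_h (lik h ^+ 2 * F h)%:E.
Proof.
move=> mF F0.
have mL := @measurable_lik t.+1; have mF1 := measurable_hist_fst mF.
have mw2 : measurable_fun setT (fun u => w u ^+ 2)%R by mreal.
rewrite integral_lawS; last 2 first.
- by apply/measurable_EFinP; apply: measurable_funM => //; mreal.
- by move=> h; rewrite lee_fin mulr_ge0// sqr_ge0.
apply: ge0_le_lower_integral => h.
  apply: integral_ge0 => pi _; apply: integral_ge0 => z _.
  by rewrite lee_fin mulr_ge0// sqr_ge0.
have c0 : (0 <= lik h ^+ 2 * F h)%R by rewrite mulr_ge0// sqr_ge0.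
rewrite /=; case: (used h).
  have -> : \int[alg t h]_pi \int[Mb pi]_z ((lik h * w (pi, z)) ^+ 2 * F h)%:E =
      \int[alg t h]_pi \int[Mb pi]_z (lik h ^+ 2 * F h * w (pi, z) ^+ 2)%:E.
    by apply: eq_integral => pi _; apply: eq_integral => z _; congr EFin; ring.
  rewrite (pull h mw2)//; last by move=> u; exact: sqr_ge0.
  by rewrite -[X in _ <= X]mule1 lee_wpmul2l.
rewrite mulr1.
under eq_integral do rewrite integral_cst_probability.
by rewrite integral_cst_prob ?prob_kernel.
Qed.

Lemma lik_sq_le1 t : \int[lawb t]_h (lik h ^+ 2)%:E <= 1.
Proof.
elim: t => [|t IH].
  by rewrite /= expr1n integral_cst_probability.
apply: le_trans IH.
have := @lik_sq_super t (cst 1%R) (measurable_cst _) (fun=> ler01).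
under eq_integral do rewrite mulr1.
by under [X in _ <= X]eq_integral do rewrite mulr1.
Qed.

Let mK t : measurable_fun setT (fun h : hist t => acc G h).
Proof. exact: (measurable_acc alg th mgb gb0 measurable_gap gap_ge0). Qed.

Let K0 t (h : hist t) : (0 <= acc G h)%R.
Proof. exact: (acc_ge0 alg gb th measurable_gap gap_ge0 gap_le2). Qed.

(** In a used round the mean of [w] is [1 - g / 2], where [g] is the increment of the budget [k],
    and [(1 - g / 2) * (1 + k + g) = 1 + k + g * (1 - k - g) / 2] with [k + g <= kap <= 1]. In other
    rounds [lik] is constant and the capped budget does not decrease. *)
Lemma lik_sub t : 1 <= \int[lawb t]_h (lik h * (1 + Num.min (acc G h) kap))%:E.
Proof.
have f0 s (h : hist s) : (0 <= lik h * (1 + Num.min (acc G h) kap))%R.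
  by rewrite mulr_ge0 ?lik_ge0// addr_ge0// le_min K0.
elim: t => [|t IH].
  by rewrite /= mul1r min_l// addr0 integral_cst_probability.
apply: (le_trans IH); rewrite integral_lawS; last 2 first.
- have mL := @measurable_lik t.+1; have mK' := @mK t.+1.
  by apply/measurable_EFinP; apply: measurable_funM => //; mreal.
- by move=> h; rewrite lee_fin f0.
apply: ge0_le_lower_integral => h; first by rewrite lee_fin f0.
rewrite /=; case: (boolP (used h)) => [/andP[ah Kh]|_].
  rewrite ah (min_l Kh).
  have Kh' : (acc G h <= kap)%R by apply: le_trans Kh; rewrite lerDl.
  rewrite (min_l Kh').
  have c0 : (0 <= lik h * (1 + (acc G h + avg G h)))%R.
    by rewrite mulr_ge0 ?lik_ge0// addr_ge0// addr_ge0.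
  have -> : \int[alg t h]_pi \int[Mb pi]_z
        (lik h * w (pi, z) * (1 + (acc G h + avg G h)))%:E =
      \int[alg t h]_pi \int[Mb pi]_z
        (lik h * (1 + (acc G h + avg G h)) * w (pi, z))%:E.
    by apply: eq_integral => pi _; apply: eq_integral => z _; congr EFin; ring.
  rewrite (pull h mw)// avg_w -EFinM lee_fin -mulrA ler_wpM2l ?lik_ge0//.
  have := avgG0 h; move: (avg G h) (acc G h) Kh (K0 h) => g k Kh k0 g0.
  have kg : (0 <= 1 - (k + g))%R by rewrite subr_ge0 (le_trans Kh).
  have := mulr_ge0 g0 kg; lra.
rewrite mulr1.
under [leRHS]eq_integral do rewrite integral_cst_probability.
rewrite integral_cst_prob ?prob_kernel// lee_fin ler_wpM2l ?lik_ge0// lerD2l.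
apply: le_min2 => //.
by rewrite lerDl; case: ifP.
Qed.

Definition alive t (h : hist t) : bool := act h && (acc G h <= kap)%R.

Lemma measurable_alive t : measurable_fun setT (@alive t).
Proof.
have ma := measurable_active alg th mgb gb0 (t := t).
by apply: measurable_and => //; apply: measurable_fun_ler => //; exact: mK.
Qed.

(** Being alive after a round means that the budget held with that round included, so on alive
    histories [lik] is the full product of the [w]'s. *)
Lemma alive_used t (h : hist t.+1) : alive h -> used h.1.
Proof.
move=> /andP[/active_prev ah]; rewrite /= ah => Kh.
by rewrite /used ah.
Qed.

Lemma alive_prev t (h : hist t.+1) : alive h -> alive h.1.
Proof.
move=> /alive_used/andP[ah Kh]; rewrite /alive ah/=.
by apply: le_trans Kh; rewrite lerDl.
Qed.

Let al t (h : hist t) : \bar R := ((alive h)%:R)%:E.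

Let al0 t (h : hist t) : 0 <= al h. Proof. by rewrite lee_fin. Qed.

Let mal t : measurable_fun setT (@al t).
Proof.
apply/measurable_EFinP.
rewrite (_ : (fun h => _) = fun h : hist t => if alive h then 1%R else 0%R).
  by apply: measurable_fun_ifT; [exact: measurable_alive|mreal|mreal].
by apply/funext => h; case: (alive h).
Qed.

(** Change of law from [Mb] to [M], one round at a time from the last. The restriction to alive
    histories guarantees that every round was active, where [p] controls the decisions, and that
    [lik] omits no factor. *)
Lemma lik_transfer t (F : hist t -> \bar R) : (t <= T)%N ->
  measurable_fun setT F -> (forall h, 0 <= F h) ->
  \int[lawb t]_h ((lik h ^+ 2)%:E * (al h * F h)) <=
  \int[lawm t]_h (al h * F h).
Proof.
elim: t F => [|t IH] F tT mF F0.
  rewrite /=; under eq_integral do rewrite expr1n mul1e.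
  exact: lexx.
pose F1 h := al h * F h.
have mF1 : measurable_fun setT F1 by exact: emeasurable_funM.
have F10 h : 0 <= F1 h by rewrite mule_ge0.
pose Phi h := \int[alg t h]_pi \int[M pi]_z F1 (h, (pi, z)).
have mPhi : measurable_fun setT Phi by exact: (measurable_step alg mM mF1 F10).
have Phi0 h : 0 <= Phi h.
  by apply: integral_ge0 => pi _; apply: integral_ge0 => z _.
have mL2 : measurable_fun setT (fun h : hist t => (lik h ^+ 2)%:E).
  by apply/measurable_EFinP; have := @measurable_lik t => ?; mreal.
have mL3 : measurable_fun setT (fun h : hist t.+1 => (lik h ^+ 2)%:E).
  by apply/measurable_EFinP; have := @measurable_lik t.+1 => ?; mreal.
have l0 s (h : hist s) : 0 <= (lik h ^+ 2)%:E by rewrite lee_fin sqr_ge0.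
have mact := measurable_active alg th mgb gb0 (t := t).
have mactR : measurable_fun setT (fun x : hist t * Pi => ((act x.1)%:R : R)%:E).
  apply: (measurableT_comp (f := fun h : hist t => ((act h)%:R : R)%:E)) => //.
  apply/measurable_EFinP.
  rewrite (_ : (fun h => _) = fun h : hist t => if act h then 1%R else 0%R).
    by mreal.
  by apply/funext => h; case: (act h).
pose F2 (u : (hist t * Pi) * (R * O)) : \bar R :=
  (lik u.1.1 ^+ 2)%:E * F1 (u.1.1, (u.1.2, u.2)).
have massoc : measurable_fun setT
    (fun u : (hist t * Pi) * (R * O) => (u.1.1, (u.1.2, u.2))).
  apply/measurable_fun_pairP; split => /=.
    exact: (measurableT_comp measurable_fst measurable_fst).
  apply/measurable_fun_pairP; split => /=.
    exact: (measurableT_comp measurable_snd measurable_fst).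
  exact: measurable_snd.
have mF2 : measurable_fun setT F2.
  apply: emeasurable_funM; last exact: (measurableT_comp mF1 massoc).
  apply: (measurableT_comp mL2).
  exact: (measurableT_comp measurable_fst measurable_fst).
have F20 u : 0 <= F2 u by rewrite mule_ge0.
(* The last round is exchanged with the earlier weights still in the integrand; the induction
   hypothesis then treats [Phi], in which that round is already integrated under [M]. *)
have key := w_transfer mact (J := joint t) (fun N mN pN => joint_null tT mN pN) mF2 F20.
have mw2 : measurable_fun setT (fun u : (hist t * Pi) * (R * O) => (w (u.1.2, u.2) ^+ 2)%:E).
  apply/measurable_EFinP; apply: measurable_funX; apply: (measurableT_comp mw).
  apply/measurable_fun_pairP; split => /=.
    exact: (measurableT_comp measurable_snd measurable_fst).
  exact: measurable_snd.
have mF2w : measurable_fun setT (fun u => F2 u * (w (u.1.2, u.2) ^+ 2)%:E).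
  exact: emeasurable_funM.
have act0 (b : bool) : 0 <= (b%:R : R)%:E by rewrite lee_fin.
have msb := measurable_fun_integral_finite_kernel _ (ksnd (W := hist t) (kmod mMb)).
have msm := measurable_fun_integral_finite_kernel _ (ksnd (W := hist t) (kmod mM)).
have keyL : \int[lawb t.+1]_h ((lik h ^+ 2)%:E * F1 h) <=
    \int[joint t]_x (((act x.1)%:R)%:E *
      \int[Mb x.2]_y (F2 (x, y) * (w (x.2, y) ^+ 2)%:E)).
  rewrite integral_lawS; last 2 first.
  - exact: emeasurable_funM.
  - by move=> h; rewrite mule_ge0.
  rewrite integral_joint; last 2 first.
  - apply: emeasurable_funM => //.
    apply: (msb (fun u => F2 u * (w (u.1.2, u.2) ^+ 2)%:E)) => // u.
    by rewrite mule_ge0// lee_fin sqr_ge0.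
  - move=> x; rewrite mule_ge0//; apply: integral_ge0 => z _.
    by rewrite mule_ge0// lee_fin sqr_ge0.
  apply: ge0_le_lower_integral => h.
    apply: integral_ge0 => pi _; apply: integral_ge0 => z _.
    by rewrite mule_ge0.
  apply: ge0_le_lower_integral => pi.
    by apply: integral_ge0 => z _; rewrite mule_ge0.
  rewrite /=; case ah: (act h); last first.
    rewrite mul0e integral0_eq// => z _; rewrite /F1 /al.
    case: (boolP (alive _)) => [/alive_prev/andP[]/=|_]; first by rewrite ah.
    by rewrite mul0e mule0.
  rewrite mul1e; apply: ge0_le_lower_integral => z; first by rewrite mule_ge0// lee_fin sqr_ge0.
  rewrite /F2 /=; case: (boolP (alive ((h, (pi, z)) : hist t.+1))) => [/alive_used /= ->|nal].
    by rewrite exprMn EFinM muleAC.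
  by rewrite /F1 /al (negbTE nal) mul0e !mule0 mul0e.
have keyR : \int[joint t]_x (((act x.1)%:R)%:E * \int[M x.2]_y F2 (x, y)) <=
    \int[lawb t]_h ((lik h ^+ 2)%:E * (al h * Phi h)).
  rewrite integral_joint; last 2 first.
  - by apply: emeasurable_funM => //; apply: (msm F2).
  - by move=> x; rewrite mule_ge0//; apply: integral_ge0.
  apply: ge0_le_lower_integral => h.
    by apply: integral_ge0 => pi _; rewrite mule_ge0//; apply: integral_ge0.
  have mFh : measurable_fun setT (fun u => F1 (h, u)).
    exact: (measurableT_comp mF1 (pair1_measurable h)).
  have e1 pi : \int[M pi]_y F2 ((h, pi), y) = (lik h ^+ 2)%:E * \int[M pi]_z F1 (h, (pi, z)).
    rewrite -ge0_integralZl//.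
    exact: (measurableT_comp mFh (pair1_measurable pi)).
  have e2 : \int[alg t h]_pi ((lik h ^+ 2)%:E * \int[M pi]_z F1 (h, (pi, z))) =
      (lik h ^+ 2)%:E * Phi h.
    rewrite ge0_integralZl//.
      exact: (measurable_integral_kmod mM mFh).
    by move=> pi _; exact: integral_ge0.
  have [ah|ah] := boolP (alive h).
    rewrite /al ah mul1e -e2; apply: ge0_le_lower_integral => pi.
      by rewrite mule_ge0//; apply: integral_ge0.
    by rewrite e1 /=; case: (act h); rewrite ?mul1e// mul0e mule_ge0//; apply: integral_ge0.
  rewrite integral0_eq; first by rewrite mule_ge0// mule_ge0.
  move=> pi _; rewrite [X in _ * X]integral0_eq ?mule0// => z _.
  rewrite /F2 /F1 /al /=; case: (boolP (alive _)) => [/alive_prev/=|_].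
    by rewrite (negbTE ah).
  by rewrite mul0e mule0.
apply: (le_trans keyL); apply: (le_trans key); apply: (le_trans keyR).
apply: (le_trans (IH Phi (ltnW tT) mPhi Phi0)).
have -> : \int[lawm t.+1]_h (al h * F h) = \int[lawm t]_h Phi h.
  exact: (integral_lawS alg mM mF1 F10).
apply: ge0_le_lower_integral => h; first by rewrite mule_ge0.
by rewrite /al; case: (alive h); rewrite ?mul1e// mul0e.
Qed.

Section regret.
Variables (u : Pi -> R) (c : R).
Hypotheses (mu : measurable_fun setT u) (u0 : forall pi, (0 <= u pi)%R).
Hypothesis uc : forall pi, (u pi <= c)%R.

Let R0 t (h : hist t) : (0 <= acc u h)%R.
Proof. exact: (acc_ge0 alg gb th mu u0 uc). Qed.
Let a0 t (h : hist t) : (0 <= avg u h)%R.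
Proof. exact: (avg_ge0 alg mu u0 uc). Qed.
Let mR t : measurable_fun setT (fun h : hist t => acc u h).
Proof. exact: (measurable_acc alg th mgb gb0 mu u0). Qed.
Let ma t : measurable_fun setT (fun h : hist t => avg u h).
Proof. exact: (measurable_avg alg mu u0). Qed.

(** Summation round by round: [lik_sq_super] moves the weight of each increment back to the time
    when its decision was made. A nonzero increment within the budget comes from an alive
    history. *)
Lemma lik_acc_le t :
  \int[lawb t]_h (lik h ^+ 2 * (if (acc G h <= kap)%R then acc u h else 0%R))%:E <=
  \sum_(s < t) \int[lawb s]_h (lik h ^+ 2 * (if alive h then avg u h else 0%R))%:E.
Proof.
elim: t => [|t IH].
  by rewrite big_ord0 integral0_eq// => h _; rewrite /= if_same mulr0.
rewrite big_ord_recr /=.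
pose F (h : hist t) : R := ((if (acc G h <= kap)%R then acc u h else 0%R) +
  (if alive h then avg u h else 0%R))%R.
have mG' := @mK t; have mR' := @mR t; have ma' := @ma t.
have mal' := @measurable_alive t; have ml' := @measurable_lik t.
have mF : measurable_fun setT F by rewrite /F; mreal.
have p1 s (h : hist s) : (0 <= (if (acc G h <= kap)%R then acc u h else 0%R))%R by case: ifP.
have p2 s (h : hist s) : (0 <= (if alive h then avg u h else 0%R))%R by case: ifP.
have F0 h : (0 <= F h)%R by rewrite addr_ge0.
apply: le_trans (leeD IH (lexx _)).
rewrite -ge0_integralD_EFin//; try solve [mreal | by move=> h; rewrite mulr_ge0// sqr_ge0].
have -> : \int[lawb t]_h (lik h ^+ 2 * (if (acc G h <= kap)%R then acc u h else 0) +
     lik h ^+ 2 * (if alive h then avg u h else 0))%:E = \int[lawb t]_h (lik h ^+ 2 * F h)%:E.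
  by apply: eq_integral => h _; rewrite -mulrDr.
apply: le_trans (lik_sq_super mF F0).
apply: ge0_le_lower_integral => h; rewrite lee_fin.
  by apply: mulr_ge0; [exact: sqr_ge0|exact: (p1 t.+1 h)].
apply: ler_wpM2l; first exact: sqr_ge0.
rewrite /F /alive /=; case: (boolP (act h.1)) => ah; rewrite ?addr0//=.
case: ifP => [Kh|_]; last by rewrite addr_ge0//; case: ifP.
have -> : (acc G h.1 <= kap)%R by apply: le_trans Kh; rewrite lerDl.
by [].
Qed.

Lemma lik_regret t : (t <= T)%N ->
  \int[lawb t]_h (lik h ^+ 2 * (if (acc G h <= kap)%R then acc u h else 0%R))%:E <=
  \sum_(s < t) \int[lawm s]_h (avg u h)%:E.
Proof.
move=> tT; apply: (le_trans (lik_acc_le t)).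
apply: lee_sum => s _.
have sT : (s <= T)%N by rewrite (leq_trans _ tT)// ltnW.
have mE : measurable_fun setT (fun h : hist s => (avg u h)%:E) by exact/measurable_EFinP.
have E0 (h : hist s) : 0 <= (avg u h)%:E by rewrite lee_fin.
have := lik_transfer sT mE E0 => /le_trans H.
rewrite (eq_integral (fun h => (lik h ^+ 2)%:E * (al h * (avg u h)%:E))).
  apply: H; apply: ge0_le_lower_integral => h; first by rewrite mule_ge0.
  by rewrite /al; case: (alive h); rewrite ?mul1e// mul0e.
move=> h _; rewrite EFinM /al; congr (_ * _).
by case: (alive h); rewrite ?mul1e// mul0e.
Qed.

End regret.
End process.
End likelihood.

(** * Models and the lower bound *)

Section models_facts.
Local Open Scope ereal_scope.
Context (R : realType) d1 d2 (Pi : measurableType d1) (O : measurableType d2).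
Implicit Types M : model R Pi O.

(** Rewards lie in the unit interval only almost surely; clipping keeps the means and provides
    integrands bounded everywhere. *)
Definition clip (r : R) : R := Num.max 0%R (Num.min 1%R r).

Lemma clip01 r : (0 <= clip r <= 1)%R.
Proof. by rewrite /clip le_max lexx/= ge_max ler01/= ge_min lexx. Qed.

Let clipZ (z : R * O) : R := clip z.1.

Let mclipZ : measurable_fun setT clipZ.
Proof.
have m1 : measurable_fun setT (fun z : R * O => z.1) by exact: measurable_fst.
by rewrite /clipZ /clip; apply: measurable_maxr => //; mreal.
Qed.

Lemma fM_clip M pi : Mplus M -> fM M pi = \int[M pi]_z (clip z.1)%:E.
Proof.
move=> [_ M01]; apply: ae_eq_integral => //.
- by apply/measurable_EFinP; exact: measurable_fst.
- exact/measurable_EFinP.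
have mI : measurable ([set` `[0%R, 1%R]] `*` [set: O] : set (R * O)).
  exact: measurableX.
exists (~` ([set` `[0%R, 1%R]] `*` [set: O])); split.
- exact: measurableC.
- by rewrite [LHS]probability_setC// M01 subee.
- move=> z /= Hz; apply: contra_not Hz => -[z01 _] _.
  move: z01; rewrite /= in_itv/= => /andP[z0 z1].
  by rewrite /clip min_r// max_r.
Qed.

Definition fR M pi : R := fine (fM M pi).
Definition fsup M : R := fine (ereal_sup (range (fM M))).
Definition gR M pi : R := (fsup M - fR M pi)%R.

Section one.
Variable M : model R Pi O.
Hypothesis HM : Mplus M.

Let mM : forall A, measurable A -> measurable_fun setT (fun pi => M pi A).
Proof. by case: HM. Qed.

Lemma fM_ge0 pi : 0 <= fM M pi.
Proof.
by rewrite fM_clip//; apply: integral_ge0 => z _; rewrite lee_fin; have /andP[] := clip01 z.1.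
Qed.

Lemma fM_le1 pi : fM M pi <= 1.
Proof.
rewrite fM_clip// -[X in _ <= X](integral_cst_probability (M pi)).
apply: ge0_le_lower_integral => z; rewrite lee_fin; by have /andP[] := clip01 z.1.
Qed.

Lemma fRE pi : fM M pi = (fR M pi)%:E.
Proof.
by rewrite /fR fineK// ge0_fin_numE ?fM_ge0// (le_lt_trans (fM_le1 pi))// ltry.
Qed.

Lemma fsupE : ereal_sup (range (fM M)) = (fsup M)%:E.
Proof.
have le1 : ereal_sup (range (fM M)) <= 1.
  by apply: ge_ereal_sup => _ [pi _ <-]; exact: fM_le1.
have ge0 : 0 <= ereal_sup (range (fM M)).
  apply: (le_trans (fM_ge0 point)); apply: ereal_sup_ubound.
  by exists point.
by rewrite /fsup fineK// ge0_fin_numE// (le_lt_trans le1)// ltry.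
Qed.

Lemma gRE pi : gM M pi = (gR M pi)%:E.
Proof. by rewrite /gM fsupE fRE -EFinB. Qed.

Lemma gR_ge0 pi : (0 <= gR M pi)%R.
Proof.
rewrite subr_ge0 -lee_fin -fsupE -fRE.
by apply: ereal_sup_ubound; exists pi.
Qed.

Lemma gR_le1 pi : (gR M pi <= 1)%R.
Proof.
have s1 : (fsup M <= 1)%R.
  by rewrite -lee_fin -fsupE; apply: ge_ereal_sup => _ [x _ <-]; exact: fM_le1.
have f0 : (0 <= fR M pi)%R by rewrite -lee_fin -fRE fM_ge0.
by rewrite /gR; lra.
Qed.

Lemma measurable_fR : measurable_fun setT (fR M).
Proof.
have mf : measurable_fun setT (fun pi => \int[M pi]_z (clip z.1)%:E).
  apply: measurable_fun_integral_kernel => //.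
  - by move=> z; rewrite lee_fin; have /andP[] := clip01 z.1.
  - exact/measurable_EFinP.
rewrite (_ : fR M = fine \o (fun pi => \int[M pi]_z (clip z.1)%:E)).
  exact: measurableT_comp.
by apply/funext => pi; rewrite /fR fM_clip.
Qed.

Lemma measurable_gR : measurable_fun setT (gR M).
Proof. by have m := measurable_fR; rewrite /gR; mreal. Qed.

(** Stands in for a maximizer, which need not exist. *)
Lemma near_optimal (e : R) : (0 < e)%R -> exists pi, (gR M pi <= e)%R.
Proof.
move=> e0.
have lt : (fsup M - e)%:E < ereal_sup (range (fM M)).
  by rewrite fsupE lte_fin gtrBl.
have [_ [pi _ <-]] := ereal_sup_gt lt.
by rewrite fRE lte_fin => H; exists pi; rewrite /gR; lra.
Qed.

End one.

(** The one-sided bound is applied to the clipped reward and to its complement to 1, giving both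
    signs of the difference. *)
Lemma fR_diff M M' pi (la : R) : Mplus M -> Mplus M' -> (0 < la)%R ->
  (`|fR M pi - fR M' pi|)%:E <=
  (la / 2)%:E * hellinger_sq (M pi) (M' pi) + (2 / la)%:E.
Proof.
move=> HM HM' la0.
have r01 z : (0 <= clipZ z <= 1)%R by exact: clip01.
have r01' z : (0 <= 1 - clipZ z <= 1)%R by have /andP[] := r01 z; lra.
have mr' : measurable_fun setT (fun z => 1 - clipZ z)%R by mreal.
have i1 : \int[M pi]_z (clipZ z)%:E = (fR M pi)%:E by rewrite -fRE// fM_clip.
have i2 : \int[M' pi]_z (clipZ z)%:E = (fR M' pi)%:E by rewrite -fRE// fM_clip.
have r0 z : (0 <= clipZ z)%R by have /andP[] := r01 z.
have r0' z : (0 <= 1 - clipZ z)%R by have /andP[] := r01' z.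
have compl (P : probability (R * O)%type R) (a : R) : \int[P]_z (clipZ z)%:E = a%:E ->
    \int[P]_z (1 - clipZ z)%:E = (1 - a)%:E.
  move=> Pa.
  have : \int[P]_z (1 - clipZ z)%:E + \int[P]_z (clipZ z)%:E = 1.
    rewrite -ge0_integralD_EFin//.
    under eq_integral do rewrite subrK.
    exact: integral_cst_probability.
  by rewrite Pa EFinB => <-; rewrite addeK.
have := @hellinger_sq_mean_diff _ _ _ (M pi) (M' pi) clipZ la mclipZ r01 la0.
have := @hellinger_sq_mean_diff _ _ _ (M pi) (M' pi) _ la mr' r01' la0.
rewrite (compl _ _ i1) (compl _ _ i2) i1 i2.
have := hellinger_sq_ge0 (M pi) (M' pi).
case: (hellinger_sq _ _) => [x| |] // x0.
  rewrite -EFinM -!EFinD !lee_fin => A B.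
  by rewrite ler_norml; apply/andP; split; lra.
by move=> _ _; rewrite gt0_muley ?lte_fin ?divr_gt0// leey.
Qed.

(** [fR_diff] with [la = 2 / eps] bounds the difference by [h / eps + eps], where [h] is the squared
    Hellinger distance. *)
Lemma fR_diff_mean (p : probability Pi R) M M' (eps : R) :
  Mplus M -> Mplus M' -> (0 < eps)%R ->
  \int[p]_pi hellinger_sq (M pi) (M' pi) <= (eps ^+ 2)%:E ->
  \int[p]_pi (`|fR M pi - fR M' pi|)%:E <= (2 * eps)%:E.
Proof.
move=> HM HM' e0 H.
pose D pi := `|fR M pi - fR M' pi|%R.
have mD : measurable_fun setT D.
  have := measurable_fR HM; have := measurable_fR HM' => *.
  by apply: measurableT_comp => //; mreal.
(* A measurable minorant of the squared Hellinger distance, to which additivity of the integral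
   applies. *)
pose m pi : R := Num.max 0%R (eps * D pi - eps ^+ 2)%R.
have mm : measurable_fun setT m by rewrite /m; apply: measurable_maxr; mreal.
have m0 pi : (0 <= m pi)%R by rewrite /m le_max lexx.
have mh : \int[p]_pi (m pi)%:E <= (eps ^+ 2)%:E.
  apply: le_trans H; apply: ge0_le_lower_integral => pi; first by rewrite lee_fin.
  rewrite /m EFin_max ge_max hellinger_sq_ge0/=.
  have la0 : (0 < 2 / eps)%R by rewrite divr_gt0.
  have := fR_diff pi HM HM' la0; rewrite -/(D pi).
  have := hellinger_sq_ge0 (M pi) (M' pi).
  case: (hellinger_sq _ _) => [x| |] // x0; last by rewrite leey.
  rewrite -EFinM -!EFinD !lee_fin.
  have -> : (2 / eps / 2 * x + 2 / (2 / eps) = (x + eps ^+ 2) / eps)%R.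
    by field; rewrite gt_eqF.
  by rewrite ler_pdivlMr// mulrC; lra.
have eD : eps%:E * \int[p]_pi (D pi)%:E <= (eps ^+ 2 + eps ^+ 2)%:E.
  rewrite -ge0_integralZ_EFin//; [|by move=> pi; exact: normr_ge0|exact: ltW].
  apply: (@le_trans _ _ (\int[p]_pi (m pi + eps ^+ 2)%:E)).
    apply: ge0_le_lower_integral => pi; rewrite lee_fin.
      by rewrite mulr_ge0 ?normr_ge0// ltW.
    by rewrite -lerBlDr /m le_max lexx orbT.
  rewrite ge0_integralD_EFin//; last by move=> pi; exact: sqr_ge0.
  by rewrite integral_cst_probability EFinD leeD2r.
rewrite -(@lee_pmul2l _ eps%:E)// -EFinM.
by apply: (le_trans eD); rewrite lee_fin; lra.
Qed.

End models_facts.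

(** Integrates the pointwise inequality on which [dec_regret] rests; nonnegativity of all terms
    replaces integrability. *)
Lemma integral_budget d (X : measurableType d) (R : realType)
    (P : probability X R) (B L K E : X -> R) (q : R) :
  measurable_fun setT B -> measurable_fun setT L ->
  measurable_fun setT K -> measurable_fun setT E ->
  (forall x, 0 <= B x) -> (forall x, 0 <= L x) ->
  (forall x, 0 <= K x) -> (forall x, 0 <= E x) -> 0 <= q ->
  (\int[P]_x (5 / 4 * (q * B x + (4^-1 * L x + (4^-1 + (4 * K x + q * E x)))))%:E =
  (5 / 4)%:E * (q%:E * \int[P]_x (B x)%:E + (4^-1%:E * \int[P]_x (L x)%:E +
    (4^-1%:E + (4%:E * \int[P]_x (K x)%:E + q%:E * \int[P]_x (E x)%:E)))))%E.
Proof.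
move=> mB mL mK mE B0 L0 K0 E0 q0.
rewrite ge0_integralZ_EFin; [|by mreal|by nneg|by lra].
rewrite ge0_integralD_EFin; [|by mreal|by mreal|by nneg|by nneg].
rewrite ge0_integralZ_EFin//.
rewrite ge0_integralD_EFin; [|by mreal|by mreal|by nneg|by nneg].
rewrite ge0_integralZ_EFin//.
rewrite ge0_integralD_EFin; [|by mreal|by mreal|by nneg|by nneg].
rewrite integral_cst_probability.
rewrite ge0_integralD_EFin; [|by mreal|by mreal|by nneg|by nneg].
by rewrite !ge0_integralZ_EFin.
Qed.

(** * The regret bound at one reference model *)

Section core.
Local Open Scope ereal_scope.
Context (R : realType) d1 d2 (Pi : measurableType d1) (O : measurableType d2).

Lemma exp_regretE (alg : algorithm R Pi O) (M : model R Pi O) (HM : Mplus M)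
    (mM : forall A, measurable A -> measurable_fun setT (fun pi => M pi A)) T :
  exp_regret alg M T = \sum_(t < T) \int[law alg mM t]_h (avg alg (gR M) h)%:E.
Proof.
apply: eq_bigr => t _.
have mg := measurable_gR HM; have g0 := gR_ge0 HM; have g1 := gR_le1 HM.
have -> : (fun h : hist R Pi O t => \int[alg t h]_pi gM M pi) =
    (fun h => (avg alg (gR M) h)%:E).
  apply/funext => h; rewrite (avgE alg mg g0 g1).
  by apply: eq_integral => pi _; rewrite gRE.
rewrite (EhistE alg mM)//.
  by apply/measurable_EFinP; exact: (measurable_avg alg mg g0).
by move=> h; rewrite lee_fin (avg_ge0 alg mg g0 g1).
Qed.

Lemma exp_regret_ge0 (alg : algorithm R Pi O) (M : model R Pi O) T :
  Mplus M -> 0 <= exp_regret alg M T.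
Proof.
move=> HM; rewrite (exp_regretE alg HM (proj1 HM)).
apply: sume_ge0 => t _; apply: integral_ge0 => h _.
by rewrite lee_fin (avg_ge0 alg (measurable_gR HM) (gR_ge0 HM) (gR_le1 HM)).
Qed.

(* Either the process is never stopped and collects [a] at every round, or it
   was stopped because [gb] alone had accumulated more than [th]. *)
Lemma acc_ge (alg : algorithm R Pi O) (gb gm e : Pi -> R) (a th cg ce : R) (T : nat) :
  measurable_fun setT gb -> (forall pi, 0 <= gb pi <= 1)%R ->
  measurable_fun setT gm -> (forall pi, 0 <= gm pi <= cg)%R ->
  measurable_fun setT e -> (forall pi, 0 <= e pi <= ce)%R ->
  (0 <= a)%R -> (th = T%:R * a)%R ->
  (forall pi, a + gb pi <= gm pi + e pi)%R ->
  forall h : hist R Pi O T, (th <= acc alg gb th gm h + acc alg gb th e h)%R.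
Proof.
move=> mgb gb01 mgm gm01 me e01 a0 thE dom h.
have gb0 pi : (0 <= gb pi)%R by have /andP[] := gb01 pi.
have gb1 pi : (gb pi <= 1)%R by have /andP[] := gb01 pi.
have gm0 pi : (0 <= gm pi)%R by have /andP[] := gm01 pi.
have gm1 pi : (gm pi <= cg)%R by have /andP[] := gm01 pi.
have e0 pi : (0 <= e pi)%R by have /andP[] := e01 pi.
have e1 pi : (e pi <= ce)%R by have /andP[] := e01 pi.
have avg_dom t (k : hist R Pi O t) : (a + avg alg gb k <= avg alg gm k + avg alg e k)%R.
  rewrite -lee_fin !EFinD (avgE alg mgb gb0 gb1) (avgE alg mgm gm0 gm1) (avgE alg me e0 e1).
  rewrite -[X in X + _ <= _](@integral_cst_prob _ _ _ (alg t k)) ?prob_kernel//.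
  rewrite -!ge0_integralD_EFin//.
  apply: ge0_le_lower_integral => pi; rewrite lee_fin//.
  by rewrite addr_ge0.
have [H1 H2] : (cumgap alg gb th h <= acc alg gb th gm h + acc alg gb th e h)%R /\
    ((th < cumgap alg gb th h)%R \/
     (T%:R * a <= acc alg gb th gm h + acc alg gb th e h)%R).
  (* The threshold must stay fixed while the number of rounds varies, so its value [T * a] is
     forgotten during the induction. *)
  clear thE; elim: T h => [|T IH] h /=.
    by split; [rewrite addr0|right; rewrite mul0r addr0].
  have [I1 I2] := IH h.1; have D := avg_dom T h.1.
  have -> : active alg gb th h.1 = (cumgap alg gb th h.1 <= th)%R by [].
  case: ifPn => A.
    have I3 : (T%:R * a <= acc alg gb th gm h.1 + acc alg gb th e h.1)%R.
      by case: I2 => //; rewrite ltNge A.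
    have Te : (T.+1%:R * a = T%:R * a + a)%R by rewrite -natr1 mulrDl mul1r.
    have g0 := avg_ge0 alg mgb gb0 gb1 h.1.
    rewrite Te; split; [lra|right; lra].
  rewrite !addr0; split => //; left.
  by rewrite ltNge.
case: H2 => [H2|H2]; first exact: le_trans (ltW H2) H1.
by rewrite [X in (X <= _)%R]thE.
Qed.

(** Since [0 <= D], the default value 0 of [sup0] is excluded and the supremum runs over a nonempty
    set. *)
Lemma dec_witness (Ms : set (model R Pi O)) (Mb : model R Pi O) (eps D : R)
    (p : probability Pi R) : (0 <= D)%R ->
  D%:E < dec_c Ms Mb eps -> exists M, [/\ Ms M,
    \int[p]_pi hellinger_sq (M pi) (Mb pi) <= (eps ^+ 2)%:E &
    D%:E < \int[p]_pi gM M pi].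
Proof.
move=> D0 /lt_le_trans Hd.
set S := [set (\int[p]_pi gM M pi)%E | M in
           [set M | Ms M /\
             (\int[p]_pi hellinger_sq (M pi) (Mb pi) <= (eps ^+ 2)%:E)%E]].
have : D%:E < Defs.sup0 S.
  by apply: Hd; apply: ereal_inf_lbound; exists p.
rewrite /Defs.sup0; case: pselect => [S0|S0 /ereal_sup_gt].
  by rewrite lte_fin ltNge D0.
by move=> [_ [M [MsM MH] <-]] DM; exists M.
Qed.

Lemma dec_regret (Ms : set (model R Pi O)) (Mb : model R Pi O) (eps D : R)
    (alg : algorithm R Pi O) (n : nat) (T := n.+1) :
  Ms `<=` Mplus (R := R) (Pi := Pi) (O := O) -> Mplus Mb ->
  (0 < eps)%R -> (T%:R * eps ^+ 2 <= 200^-1)%R ->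
  (1280 * eps <= D)%R -> (32 <= T%:R * D)%R ->
  D%:E < dec_c (Ms `|` [set Mb]) Mb eps ->
  exists M, Ms M /\ (T%:R * D / 160)%:E <= exp_regret alg M T.
Proof.
move=> MsM HMb e0 Te De TD decD.
have D0 : (0 < D)%R by lra.
have T0 : (0 < T%:R :> R)%R by rewrite ltr0n.
have mMb := proj1 HMb.
have mgb := measurable_gR HMb; have gb0 := gR_ge0 HMb; have gb1 := gR_le1 HMb.
have D32 : (0 < D / 32)%R by rewrite divr_gt0.
have [pi0 gpi0] := near_optimal HMb D32.
pose th := (T%:R * (D / 16))%R.
have th0 : (0 <= th)%R by rewrite mulr_ge0// divr_ge0// ltW.
pose p : probability Pi R := play alg th mgb gb0 mMb pi0 n.
(* [D / 16] comes from [th], [D / 32] from [pi0], and the overshoot [1 / T] is at most [D / 32]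
   because [32 <= T * D]. *)
have pgb : \int[p]_pi (gR Mb pi)%:E <= (D / 8)%:E.
  rewrite -(@lee_pmul2l _ T%:R%:E)// -EFinM.
  apply: (le_trans (play_gap_le alg mMb mgb gb0 gb1 pi0 n th0)).
  rewrite lee_fin /th.
  have : (T%:R * gR Mb pi0 <= T%:R * (D / 32))%R by rewrite ler_wpM2l// ltW.
  rewrite -/T; lra.
have [M [MM Mh Mg]] := dec_witness p (ltW D0) decD.
(* The witness is not [Mb], whose mean gap under [p] is at most [D / 8]. *)
have {}MM : Ms M.
  case: MM => // /= MMb; exfalso; move: Mg; rewrite MMb.
  have -> : \int[p]_pi gM Mb pi = \int[p]_pi (gR Mb pi)%:E.
    by apply: eq_integral => pi _; rewrite gRE.
  by move=> /lt_le_trans/(_ pgb); rewrite lte_fin; lra.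
have HM := MsM _ MM; exists M; split=> //.
have mM := proj1 HM.
have mgm := measurable_gR HM; have gm0 := gR_ge0 HM; have gm1 := gR_le1 HM.
pose e pi := `|fR M pi - fR Mb pi|%R.
have me : measurable_fun setT e.
  have := measurable_fR HM; have := measurable_fR HMb => *.
  by apply: measurableT_comp => //; mreal.
have ee0 pi : (0 <= e pi)%R by exact: normr_ge0.
have ee1 pi : (e pi <= 1)%R.
  have a1 := fM_ge0 HM pi; have a2 := fM_le1 HM pi.
  have b1 := fM_ge0 HMb pi; have b2 := fM_le1 HMb pi.
  move: a1 a2 b1 b2; rewrite !fRE// !lee_fin => a1 a2 b1 b2.
  by rewrite /e ler_norml; apply/andP; split; lra.
have pe : \int[p]_pi (e pi)%:E <= (2 * eps)%:E by exact: fR_diff_mean.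
(* The mean gap of [M] exceeds [D], yet is at most [fsup M - fsup Mb] plus the means of [gR Mb] and
   [e], which are at most [D / 8] and [2 * eps]. *)
have gap : (3 / 4 * D <= fsup M - fsup Mb)%R.
  rewrite leNgt; apply/negP => lt; move: Mg; apply/negP; rewrite -leNgt.
  apply: (@le_trans _ _ (\int[p]_pi (3 / 4 * D + (gR Mb pi + e pi))%:E)).
    apply: ge0_le_lower_integral => pi; rewrite gRE// lee_fin; first exact: gm0.
    have := ler_norm (fR Mb pi - fR M pi)%R; rewrite distrC -/(e pi) /gR; lra.
  rewrite ge0_integralD_EFin//; [|by mreal|by move=> pi; lra|by nneg].
  rewrite integral_cst_probability ge0_integralD_EFin//.
  apply: (le_trans (leeD2l _ (leeD pgb pe))).
  rewrite -!EFinD lee_fin; lra.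
have dom pi : (D / 16 + gR Mb pi <= gR M pi + e pi)%R.
  have := ler_norm (fR M pi - fR Mb pi)%R; rewrite -/(e pi) /gR; lra.
have [w [mw w0 w2 wG wtr]] := joint_density p mM mMb.
pose G := affinity_gap Mb w.
have mG : measurable_fun setT G by exact: measurable_gap.
have G0 : forall pi, (0 <= G pi)%R by move=> pi; exact: gap_ge0.
have G2 : forall pi, (G pi <= 2)%R by move=> pi; exact: gap_le2.
pose kap : R := 4^-1%R.
have kap0 : (0 <= kap)%R by rewrite invr_ge0.
have kap1 : (kap <= 1)%R by rewrite /kap; lra.
pose lik' := lik alg Mb (gR Mb) th w kap (t := T).
pose acc' u := acc alg (gR Mb) th u (t := T).
pose P := law alg mMb T.
pose B := fun h => (lik' h ^+ 2 * (if (acc' G h <= kap)%R then acc' (gR M) h else 0))%R.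
have I1 : \int[P]_h (B h)%:E <= exp_regret alg M T.
  rewrite (exp_regretE alg HM mM).
  exact: (lik_regret kap mM mw w0 w2 wtr mgm gm0 gm1 (leqnn T)).
have I2 : \int[P]_h (lik' h ^+ 2)%:E <= 1 by exact: lik_sq_le1.
have I3 : \int[P]_h (acc' G h)%:E <= (200^-1)%:E.
  apply: (le_trans (acc_le_play alg mMb th mgb gb0 pi0 n mG G0 G2)).
  apply: (@le_trans _ _ (T%:R%:E * (eps ^+ 2)%:E)); last by rewrite -EFinM lee_fin.
  by apply: lee_wpmul2l; [rewrite lee_fin ltW|exact: (le_trans wG Mh)].
have I4 : \int[P]_h (acc' e h)%:E <= (T%:R * (2 * eps))%:E.
  apply: (le_trans (acc_le_play alg mMb th mgb gb0 pi0 n me ee0 ee1)).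
  by rewrite EFinM; apply: lee_wpmul2l => //; rewrite lee_fin ltW.
have I0 := lik_sub alg mMb th mgb gb0 mw w0 w2 kap0 kap1 T.
(* Normalizes the threshold to [q * th = 2]: when the error term takes less than 1, more than 1 is
   left to the regret. *)
pose q := (32 / (T%:R * D))%R.
have q0 : (0 < q)%R by rewrite divr_gt0// mulr_gt0.
have accG0 h : (0 <= acc' G h)%R by exact: (acc_ge0 alg (gR Mb) th mG G0 G2).
have acce0 h : (0 <= acc' e h)%R by exact: (acc_ge0 alg (gR Mb) th me ee0 ee1).
have accg0 h : (0 <= acc' (gR M) h)%R by exact: (acc_ge0 alg (gR Mb) th mgm gm0 gm1).
have lik0 h : (0 <= lik' h)%R by exact: lik_ge0.
have mlik : measurable_fun setT lik' by exact: measurable_lik.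
have maccG : measurable_fun setT (acc' G) by exact: measurable_acc.
have macce : measurable_fun setT (acc' e) by exact: measurable_acc.
have maccg : measurable_fun setT (acc' (gR M)) by exact: measurable_acc.
have mB : measurable_fun setT B by rewrite /B; mreal.
have B0 h : (0 <= B h)%R by rewrite mulr_ge0 ?sqr_ge0//; case: ifP.
(* If the error or the budget is large, then [q * acc' e h >= 1] or [4 * acc' G h >= 1], and
   [lik' <= lik' ^+ 2 / 4 + 1] suffices. Otherwise [q * B h >= lik' ^+ 2], and
   [lik' <= lik' ^+ 2 + 1 / 4]. *)
have pt h : (lik' h * (1 + Num.min (acc' G h) kap) <=
    5 / 4 * (q * B h + (4^-1 * lik' h ^+ 2 + (4^-1 + (4 * acc' G h + q * acc' e h)))))%R.
  have tot : (th <= acc' (gR M) h + acc' e h)%R.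
    apply: (@acc_ge alg (gR Mb) (gR M) e (D / 16)%R th 1%R 1%R T) => //.
    - by move=> pi; rewrite gb0 gb1.
    - by move=> pi; rewrite gm0 gm1.
    - by move=> pi; rewrite ee0 ee1.
    - lra.
  have min1 : (1 + Num.min (acc' G h) kap <= 5 / 4)%R.
    have : (Num.min (acc' G h) kap <= kap)%R by rewrite ge_min lexx orbT.
    by rewrite /kap; lra.
  apply: (@le_trans _ _ (5 / 4 * lik' h)%R); first by rewrite mulrC ler_wpM2r.
  rewrite ler_pM2l//.
  have qe0 : (0 <= q * acc' e h)%R by rewrite mulr_ge0// ltW.
  have qB0 : (0 <= q * B h)%R by rewrite mulr_ge0// ltW.
  have := accG0 h; have sq := sqr_ge0 (lik' h - 2^-1); have sq2 := sqr_ge0 (lik' h - 2).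
  have qth : (q * th = 2)%R by rewrite /q /th; field; rewrite !gt_eqF.
  have qtot : (2 <= q * acc' (gR M) h + q * acc' e h)%R.
    by rewrite -mulrDr -qth ler_pM2l.
  have [qe|qe] := leP 1%R (q * acc' e h)%R; first by nra.
  rewrite /B; case: ifPn => [Gk|]; last first.
    by rewrite -ltNge /kap mulr0 mulr0 => Gk; nra.
  have qg : (1 <= q * acc' (gR M) h)%R by lra.
  have -> : (q * (lik' h ^+ 2 * acc' (gR M) h) = lik' h ^+ 2 * (q * acc' (gR M) h))%R by ring.
  have : (lik' h ^+ 2 <= lik' h ^+ 2 * (q * acc' (gR M) h))%R by rewrite ler_peMr// sqr_ge0.
  by nra.
have tot : 1 <= (5 / 4)%:E * (q%:E * \int[P]_h (B h)%:E +
    (4^-1%:E * \int[P]_h (lik' h ^+ 2)%:E + (4^-1%:E +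
    (4%:E * \int[P]_h (acc' G h)%:E + q%:E * \int[P]_h (acc' e h)%:E)))).
  apply: (le_trans I0).
  apply: (@le_trans _ _ (\int[P]_h (5 / 4 * (q * B h + (4^-1 * lik' h ^+ 2 +
      (4^-1 + (4 * acc' G h + q * acc' e h)))))%:E)).
    apply: ge0_le_lower_integral => h; rewrite lee_fin; last exact: pt.
    rewrite mulr_ge0 ?lik0// addr_ge0// le_min; apply/andP; split => //.
    exact: accG0.
  have ml2 : measurable_fun setT (fun h => lik' h ^+ 2)%R by exact: measurable_funX.
  by rewrite (integral_budget P mB ml2 maccG macce B0 (fun=> sqr_ge0 _) accG0 acce0 (ltW q0)).
have rg0 := exp_regret_ge0 alg T HM.
move: I1 rg0; case: (exp_regret alg M T) => [r| |] // I1 r0; last by rewrite leey.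
have fin : forall (F : hist R Pi O T -> R) (c : R), (forall h, 0 <= F h)%R ->
    \int[P]_h (F h)%:E <= c%:E -> exists x : R, \int[P]_h (F h)%:E = x%:E /\ (x <= c)%R.
  move=> F c F0; have : 0 <= \int[P]_h (F h)%:E by apply: integral_ge0 => h _; rewrite lee_fin.
  by case: (\int[P]_h _) => [x| |] // _ xc; exists x; split.
have [x1 [E1 X1]] := fin B r B0 I1.
have [x2 [E2 X2]] := fin (fun h => lik' h ^+ 2)%R 1%R (fun h => sqr_ge0 _) I2.
have [x3 [E3 X3]] := fin (acc' G) _ accG0 I3.
have [x4 [E4 X4]] := fin (acc' e) _ acce0 I4.
move: tot; rewrite E1 E2 E3 E4 -!EFinM !lee_fin => tot.
have q4 : (q * x4 <= 20^-1)%R.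
  apply: (@le_trans _ _ (q * (T%:R * (2 * eps)))%R); first by rewrite ler_pM2l.
  have -> : (q * (T%:R * (2 * eps)) = 64 * eps / D)%R.
    by rewrite /q; field; rewrite !gt_eqF.
  by rewrite ler_pdivrMr//; lra.
(* [4 / 5] minus [1 / 4 + 1 / 4] for the second moment and the constant, [4 / 200] for the budget
   and [1 / 20] for the error leaves more than [1 / 5]. *)
have q1 : (5^-1 <= q * r)%R.
  have : (q * x1 <= q * r)%R by rewrite ler_pM2l.
  lra.
have qV : (q^-1 = T%:R * D / 32)%R by rewrite /q invf_div.
have : (q^-1 * 5^-1 <= r)%R by rewrite ler_pdivrMl.
rewrite qV; lra.
Qed.

End core.

(** * Mixtures, and the radius at horizon [T] *)

Section hull.
Local Open Scope ereal_scope.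
Context (R : realType) d1 d2 (Pi : measurableType d1) (O : measurableType d2).

Lemma conv_hull_Mplus (Ms : set (model R Pi O)) :
  Ms `<=` Mplus (R := R) (Pi := Pi) (O := O) ->
  conv_hull Ms `<=` Mplus (R := R) (Pi := Pi) (O := O).
Proof.
move=> MsM Mb [d [Th [nu [phi [phiM [mphi MbE]]]]]]; split.
  move=> A mA.
  rewrite (_ : (fun pi => Mb pi A) = fun pi => \int[nu]_th phi th pi A); last first.
    by apply/funext => pi; rewrite MbE.
  apply: (@measurable_fun_fubini_tonelli_G _ _ _ _ R nu
    (fun z : Th * Pi => phi z.1 z.2 A)); first exact: mphi.
  by move=> z; exact: measure_ge0.
move=> pi; rewrite MbE; last exact: measurableX.
under eq_integral do rewrite (proj2 (MsM _ (phiM _))).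
exact: integral_cst_probability.
Qed.

Lemma dec_c_le1 (Ms : set (model R Pi O)) (Mb : model R Pi O) (eps : R)
    (p : probability Pi R) : Ms `<=` Mplus (R := R) (Pi := Pi) (O := O) ->
  dec_c Ms Mb eps <= 1.
Proof.
move=> MsM; apply: (@le_trans _ _ (Defs.sup0 [set (\int[p]_pi gM M pi)%E | M in
           [set M | Ms M /\
             (\int[p]_pi hellinger_sq (M pi) (Mb pi) <= (eps ^+ 2)%:E)%E]])).
  by apply: ereal_inf_lbound; exists p.
rewrite /Defs.sup0; case: pselect => S0; first exact: lee01.
apply: ge_ereal_sup => _ [M [/MsM HM _] <-].
rewrite -[X in _ <= X](integral_cst_probability p).
apply: ge0_le_lower_integral => pi; rewrite gRE// lee_fin.
  exact: gR_ge0.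
exact: gR_le1.
Qed.

End hull.

Lemma ln2_ge (R : realType) : 2^-1 <= ln 2%:R :> R.
Proof.
have := @le_ln1Dx R (- 2^-1).
have -> : 1 + - 2^-1 = 2^-1 :> R by field.
rewrite lnV ?posrE// => H.
have : - (1 : R) < - 2^-1 by lra.
by move=> /H; lra.
Qed.

Section horizon.
Context (R : realType) d1 d2 (Pi : measurableType d1) (O : measurableType d2).
Variables (Ms : set (model R Pi O)) (T : nat).
Hypothesis T2 : (2 <= T)%N.

Lemma ln_nat_ge : 2^-1 <= ln T%:R :> R.
Proof.
by apply: (le_trans (ln2_ge R)); rewrite ler_ln ?posrE ?ltr0n ?ler_nat// (leq_trans _ T2).
Qed.

(** Both [T] and [Vcl Ms >= e] are at least 2. An infinite [Vcl Ms] falls under the case where the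
    minimum is [T], so [fine] is applied to a finite value. *)
Lemma CT_ge : 2^-1 <= CT Ms T.
Proof.
rewrite /CT.
have V2 : (2%:E <= Vcl Ms)%E.
  apply: (@le_trans _ _ (expR 1)%:E); last by rewrite /Vcl le_max lexx.
  by rewrite lee_fin; have := expR_ge1Dx (1 : R); lra.
have [TV|VT] := leP (T%:R%:E) (Vcl Ms); first exact: ln_nat_ge.
have Vfin : Vcl Ms \is a fin_num.
  rewrite ge0_fin_numE; first exact: (lt_trans VT (ltry _)).
  exact: le_trans V2.
have fV : (2 <= fine (Vcl Ms))%R by rewrite -lee_fin fineK.
by apply: (le_trans (ln2_ge R)); rewrite ler_ln ?posrE// (lt_le_trans _ fV).
Qed.

Lemma eps_low_sq (c : R) : 0 <= c -> T%:R * eps_low c Ms T ^+ 2 <= 2 * c ^+ 2.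
Proof.
move=> c0; rewrite /eps_low.
have T0 : (0 : R) < T%:R by rewrite ltr0n (leq_trans _ T2).
have C0 : 0 < CT Ms T by apply: lt_le_trans CT_ge; rewrite invr_gt0.
rewrite exprMn exprVn sqr_sqrtr; last by rewrite mulr_ge0// ltW.
have -> : T%:R * (c ^+ 2 / (T%:R * CT Ms T)) = c ^+ 2 / CT Ms T.
  by field; rewrite !gt_eqF.
rewrite ler_pdivrMr//.
have := sqr_ge0 c; have := CT_ge; nra.
Qed.

Lemma eps_low_gt0 (c : R) : 0 < c -> 0 < eps_low c Ms T.
Proof.
move=> c0; rewrite divr_gt0// sqrtr_gt0 mulr_gt0//.
  by rewrite ltr0n (leq_trans _ T2).
by apply: lt_le_trans CT_ge; rewrite invr_gt0.
Qed.

End horizon.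

Theorem theorem2p2 (R : realType) :
  exists C C' c c' : R, [/\ 0 < C, 0 < C', 0 < c & 0 < c'] /\
  forall (d1 d2 : measure_display) (Pi : measurableType d1)
         (O : measurableType d2) (Ms : set (model R Pi O)),
  Ms `<=` @Mplus R _ _ Pi O ->
  forall T : nat, (2 <= T)%N ->
  let eps := eps_low c Ms T in
  ((C * eps)%:E <= dec_cM Ms eps)%E ->
  forall alg : algorithm R Pi O,
  exists Mst : model R Pi O, Ms Mst /\
    ((c'%:E * dec_cM Ms eps * (T%:R / ln T%:R)%:E
        - (C' * Num.sqrt T%:R / ln T%:R)%:E
      <= c'%:E * ereal_sup [set dec_c (Ms `|` [set Mb]) Mb eps | Mb in @Mplus R _ _ Pi O]
                 * (T%:R / ln T%:R)%:E
        - (C' * Num.sqrt T%:R / ln T%:R)%:E)%E /\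
     (c'%:E * ereal_sup [set dec_c (Ms `|` [set Mb]) Mb eps | Mb in @Mplus R _ _ Pi O]
                 * (T%:R / ln T%:R)%:E
        - (C' * Num.sqrt T%:R / ln T%:R)%:E
      <= exp_regret alg Mst T)%E).
Proof.
have c0 : 0 < 20^-1 :> R by lra.
have c'0 : 0 < 640^-1 :> R by lra.
(* [c = 1 / 20] gives [T * eps ^+ 2 <= 2 * c ^+ 2 = 1 / 200]. For [c'], [dec_regret] at [D / 2]
   yields [T * D / 320], and [ln T >= 1 / 2] costs another factor 2. *)
exists 1, 1, 20^-1, 640^-1; split; first by split.
move=> d1 d2 Pi O Ms MsM T T2 eps decM alg.
have e0 : 0 < eps by exact: eps_low_gt0.
have Te : T%:R * eps ^+ 2 <= 200^-1.
  by apply: (le_trans (eps_low_sq Ms T2 (ltW c0))); lra.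
have L2 := @ln_nat_ge R T T2.
have L0 : 0 < ln T%:R :> R by lra.
have T0 : 0 < T%:R :> R by rewrite ltr0n (leq_trans _ T2).
set S := [set dec_c (Ms `|` [set Mb]) Mb eps | Mb in @Mplus R _ _ Pi O].
have decS : (dec_cM Ms eps <= ereal_sup S)%E.
  apply: le_ereal_sup => _ [Mb /(conv_hull_Mplus MsM) HMb <-].
  by exists Mb.
(* For an empty class [dec_cM] is a supremum over the empty set, that is [-oo], against the assumed
   lower bound. *)
have [M0 M0s] : exists M0, Ms M0.
  have [Mb [d [Th [nu [phi [phiM _]]]]]] : exists Mb, conv_hull Ms Mb.
    apply/not_existsP => no; move: decM; apply/negP; rewrite -ltNge.
    rewrite /dec_cM (_ : [set _ | _ in _] = set0) ?ereal_sup0 ?ltNyr//.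
    by apply/seteqP; split => [x [Mb hMb _]|x []//]; exact: (no Mb hMb).
  by exists (phi point).
have S1 : (ereal_sup S <= 1)%E.
  apply: ge_ereal_sup => _ [Mb HMb <-].
  apply: (dec_c_le1 _ _ (kprob (alg 0%N) tt)) => M [/MsM//|/= ->//].
have eS : (eps%:E <= ereal_sup S)%E by apply: le_trans decS; rewrite mul1r in decM.
have [D SD] : exists D, ereal_sup S = D%:E.
  move: S1 eS; case: (ereal_sup S) => [D| |] //.
  by exists D.
rewrite SD in decS eS *; rewrite lee_fin in eS.
have D0 : 0 < D by exact: lt_le_trans eS.
have TL0 : 0 <= T%:R / ln T%:R :> R by rewrite divr_ge0// ltW.
have first_le : ((640^-1)%:E * dec_cM Ms eps * (T%:R / ln T%:R)%:E
        - (1 * Num.sqrt T%:R / ln T%:R)%:E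
      <= (640^-1)%:E * D%:E * (T%:R / ln T%:R)%:E
        - (1 * Num.sqrt T%:R / ln T%:R)%:E)%E.
  apply: leeB => //; apply: lee_wpmul2r; first by rewrite lee_fin.
  by apply: lee_wpmul2l => //; rewrite lee_fin ltW.
suff [M [MM H]] : exists M, Ms M /\
    ((640^-1 * D * (T%:R / ln T%:R) - 1 * Num.sqrt T%:R / ln T%:R)%:E <= exp_regret alg M T)%E.
  by exists M; split=> //; split=> //; rewrite -!EFinM -EFinB.
(* In the small case the claimed bound is at most 0, and any model of the class will do. *)
have [small|large] := leP (640^-1 * D * T%:R) (Num.sqrt T%:R).
  exists M0; split=> //; apply: (@le_trans _ _ 0%E); last exact: exp_regret_ge0 (MsM _ M0s).
  rewrite lee_fin mul1r mulrA -mulrBl; apply: mulr_le0_ge0.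
    by rewrite subr_le0.
  by rewrite invr_ge0 ltW.
have sT0 : 0 < Num.sqrt T%:R :> R by rewrite sqrtr_gt0.
have sT : Num.sqrt T%:R ^+ 2 = T%:R :> R by rewrite sqr_sqrtr// ltW.
have sT1 : 1 <= Num.sqrt T%:R :> R.
  have T1 : 1 <= T%:R :> R by rewrite ler1n (leq_trans _ T2).
  by have := ler_wsqrtr T1; rewrite sqrtr1.
set s := Num.sqrt T%:R in large sT0 sT sT1 *.
have Ds : 640 < D * s by move: large; rewrite -sT; nra.
(* The supremum over reference models need not be attained; one that reaches half of it is
   enough. *)
have : ((D / 2)%:E < ereal_sup S)%E by rewrite SD lte_fin; lra.
move=> /ereal_sup_gt[_ [Mb HMb <-] decD].
case: T T2 eps decM e0 Te L2 L0 T0 s large sT0 sT sT1 Ds S SD decS eS TL0 first_le S1 decD => // n.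
move=> T2 eps decM e0 Te L2 L0 T0 s large sT0 sT sT1 Ds S SD decS eS TL0 first_le S1 decD.
(* [14 ^+ 2 = 196 <= 200]. Together with [D * s > 640] this leaves ample room for
   [1280 * eps <= D / 2]. *)
have es : eps * s <= 14^-1.
  have : (eps * s) ^+ 2 <= (14^-1) ^+ 2.
    by rewrite exprMn sT mulrC; apply: (le_trans Te); lra.
  rewrite ler_sqr// nnegrE; last by lra.
  by apply: mulr_ge0; exact: ltW.
have h1 : 1280 * eps <= D / 2.
  by rewrite -(ler_pM2r sT0); lra.
have h2 : 32 <= n.+1%:R * (D / 2).
  by rewrite -sT; nra.
have [M [MM H]] := dec_regret alg MsM HMb e0 Te h1 h2 decD.
exists M; split=> //; apply: le_trans H; rewrite lee_fin.
have step : 640^-1 * D * (n.+1%:R / ln n.+1%:R) <= n.+1%:R * (D / 2) / 160.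
  rewrite [X in X <= _]mulrA ler_pdivrMr//.
  have DT : 0 <= D * n.+1%:R by rewrite mulr_ge0// ltW.
  have := ler_wpM2l DT L2; lra.
have : 0 <= 1 * s / ln n.+1%:R by rewrite mul1r divr_ge0// ltW.
lra.
Qed.
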